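(* Let $(\alpha_1,\dots,\alpha_{n+1})\subset\mathrm T^*$ be (the beginning of) a simple path of weights with initialization $n_0$, and let $\mathcal A_n\hookrightarrow\mathcal A_{n+1}$ be a direct filiation, $n\ge n_0$. Let $\varphi_n$ be a point of $\mathfrak L_n^{\mathrm T,\mathcal A_n}$ and $\varphi_{n+1}$ a point of $\pi_{n+1}^{-1}(\varphi_n)\cap\mathfrak L_{n+1}^{\mathrm T,\mathcal A_{n+1}}$ (assumed nonempty). Then: 1. the Zariski tangent space at each point of $\pi_{n+1}^{-1}(\varphi_n)$ is given by $\mathrm Z^2(\varphi_{n+1},\mathbb Ke_{n+1})^{\mathrm T}\simeq(\mathrm H_2(\varphi_n)_{\alpha_{n+1}})^*$; 2. the Zariski tangent space of $\pi_{n+1}^{-1}(\varphi_n)\cap\mathfrak L_{n+1}^{\mathrm T,\mathcal A_{n+1}}$ at $\varphi_{n+1}$ is given by $$\mathrm H^2(\varphi_{n+1},\mathbb Ke_{n+1})^{\mathrm T}\simeq\mathrm Z^2(\varphi_{n+1},\mathbb Ke_{n+1})^{\mathrm T}/\mathbb K\psi',$$ where $\psi$ is the cocycle defining the central extension $\varphi_{n+1}$ of $\varphi_n$ and $\psi'$ is the extension of $\psi$ which is zero on $\mathbb K^{n+1}\times\mathbb Ke_{n+1}$; it injects, via $\overline i_2$, in the Zariski tangent space of $\mathfrak L_{n+1}^{\mathrm T,\mathcal A_{n+1}}$ at $\varphi_{n+1}$; 3. $\mathrm H^2(\varphi_{n+1},\mathbb Ke_{n+1})^{\mathrm T}$ may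 be identified with the dual of the hyperplane $$\frac{(\ker\widetilde\varphi_n)_{\alpha_{n+1}}\cap\ker\widetilde\psi}{\Omega(\varphi_n)_{\alpha_{n+1}}}$$ of $\mathrm H_2(\varphi_n)_{\alpha_{n+1}}$.
   Context: $\mathbb K$ is an algebraically closed field of characteristic $0$. $\mathrm T$ is a torus (finite-dimensional $\mathbb K$-vector space) and $(\alpha_p)$ a sequence in $\mathrm T^*$; $\mathrm T$ acts on $\mathbb K^n$ by $t\cdot e_i=\alpha_i(t)e_i$. $\mathrm P_n=\{\alpha_1,\dots,\alpha_n\}$, $r=\dim\mathrm T$. $\mathfrak L_n^{\mathrm T}$ is the scheme of $\mathrm T$-invariant Lie laws on $\mathbb K^n$ ($\varphi^k_{ij}=0$ unless $\alpha_i+\alpha_j=\alpha_k$). $\Sigma_n(\mathrm T)$ is the set of $\varphi\in\mathfrak L_n^{\mathrm T}(\mathbb K)$ for which $\mathrm T$ is a maximal torus of derivations. Path of weights with initialization $n_0$: (1) $\alpha_1,\dots,\alpha_{n_0}$ span $\mathrm T^*$ and for some $t\in\mathrm T$ all $\alpha_i(t)\in\mathbb Q_{>0}$, $i\le n_0$; (2) $\Sigma_n(\mathrm T)\ne\emptyset$ for $n\ge n_0$; (3) $\alpha_{n+1}\notin\mathrm P_n-\mathrm P_n$ for $n\ge n_0$. Simple: all weights distinct. Under these hypotheses every law of $\mathfrak L_{n+1}^{\mathrm T}$ has $e_{n+1}$ central, and forgetting the coordinates $X^{n+1}_{ij}$ (i.e. taking the quotient by $\mathbb Ke_{n+1}$)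 defines a scheme morphism $\pi_{n+1}:\mathfrak L_{n+1}^{\mathrm T}\to\mathfrak L_n^{\mathrm T}$; a law $\varphi_{n+1}$ over $\varphi_n$ is $\varphi_{n+1}=\varphi_n+\psi$, $\psi\in\mathrm Z^2(\varphi_n,\mathbb Ke_{n+1})^{\mathrm T}$ (trivial coefficients). Admissible sets: let $\mathcal J$ be the set of multi-indices $\binom k{ij}$, $i<j$, $\alpha_i+\alpha_j=\alpha_k$. $\mathcal A\subset\mathcal J$ is admissible at $\varphi\in\mathfrak L_n^{\mathrm T}(\mathbb K)$ if it is minimal such that the forms $L\mapsto(d_\varphi L)^\alpha$, $\alpha\in\mathcal A$, on $\mathrm C^1(\mathbb K^n,\mathbb K^n)^{\mathrm T}$ have maximal rank $\dim\mathrm B^2(\varphi,\varphi)^{\mathrm T}$. When $|\mathcal A|=n-r$ (maximal), $\mathfrak L_n^{\mathrm T,\mathcal A}$ denotes the closed subscheme of $\mathfrak L_n^{\mathrm T}$ with $X^k_{ij}=1$ for all $\binom k{ij}\in\mathcal A$; its tangent space at a point $\varphi$ identifies with $\mathrm H^2(\varphi,\varphi)^{\mathrm T}$. A direct filiation $\mathcal A_n\hookrightarrow\mathcal A_{n+1}$ is an inclusion $\mathcal A_{n+1}=\mathcal A_n\cup\{\binom{n+1}{pq}\}$, for some $p<q$, of admissible sets with $|\mathcal A_n|=n-r$, $|\mathcal A_{n+1}|=n+1-r$, at a law of $\Sigma_n(\mathrm T)$ and at a (nontrivial) central extension of it in $\Sigma_{n+1}(\mathrm T)$, respectively. $\mathrm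 H_2(\varphi_n)$ is the homology of the Lie algebra $(\mathbb K^n,\varphi_n)$ with trivial coefficients and the subscript $\alpha_{n+1}$ denotes the weight space of $\mathrm T$ of weight $\alpha_{n+1}$. $\mathrm Z^2,\mathrm H^2(\varphi_{n+1},\mathbb Ke_{n+1})$ are cocycles and cohomology of $(\mathbb K^{n+1},\varphi_{n+1})$ with values in the central ideal $\mathbb Ke_{n+1}$; $\overline i_2:\mathrm H^2(\varphi_{n+1},\mathbb Ke_{n+1})^{\mathrm T}\to\mathrm H^2(\varphi_{n+1},\varphi_{n+1})^{\mathrm T}$ is induced by the inclusion of modules $\mathbb Ke_{n+1}\subset\mathbb K^{n+1}$. For a bilinear alternating map $h$, $\widetilde h$ is the induced linear map on $\wedge^2$: $\widetilde\varphi_n:\wedge^2\mathbb K^n\to\mathbb K^n$, $\widetilde\psi:\wedge^2\mathbb K^n\to\mathbb Ke_{n+1}$. $\Omega(\varphi_n)$ is the $\mathrm T$-submodule of $\wedge^2\mathbb K^n$ generated by the cyclic sums $\varphi_n(x,y)\wedge z+\varphi_n(y,z)\wedge x+\varphi_n(z,x)\wedge y$. *)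

(* Defs.v *)
From HB Require Import structures.
From mathcomp Require Import all_boot all_order all_algebra.
From mathcomp Require Import ring.

Set Implicit Arguments.
Unset Strict Implicit.
Unset Printing Implicit Defensive.

Import GRing.Theory.
Local Open Scope ring_scope.

(* Conventions.
   - Indices start at 0: the basis vectors of K^n are 'e_0, ..., 'e_(n-1), the
     weight of 'e_i is alpha i, and 'e_ord_max in K^(n+1) is the new vector.
   - K^n is 'rV[K]_n; a matrix L acts on it by x |-> x *m L.
   - The exterior square has the basis e_i /\ e_j, i < j, so both its elements
     and the alternating bilinear maps (given by their values on the pairs
     (e_i, e_j), i < j) are finite functions on [pairs n]. *)

Notation "''e_' i" := (delta_mx 0 i) (at level 8, i at level 2, format "''e_' i")
  : ring_scope.

Definition pairs n := {ij : 'I_n * 'I_n | (ij.1 < ij.2)%N}.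

Definition p1 n (p : pairs n) : 'I_n := (val p).1.
Definition p2 n (p : pairs n) : 'I_n := (val p).2.

Definition wid n (i : 'I_n) : 'I_n.+1 := widen_ord (leqnSn n) i.

Definition wpair n (p : pairs n) : pairs n.+1 :=
  exist _ (wid (p1 p), wid (p2 p)) (valP p).

Notation altmap n V := {ffun pairs n -> V}.

Section LinearCombinators.
Variables (A : nzRingType) (U V W : lmodType A).
Implicit Types (f h : U -> V).

Lemma linear_addf f h : linear f -> linear h -> linear (fun u => f u + h u).
Proof. by move=> lf lh a u v; rewrite lf lh scalerDr addrACA. Qed.

Lemma linear_subf f h : linear f -> linear h -> linear (fun u => f u - h u).
Proof.
by move=> lf lh a u v; rewrite lf lh scalerBr addrACA opprD.
Qed.

Lemma linear_compf (k : V -> W) f :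
  linear k -> linear f -> linear (fun u => k (f u)).
Proof. by move=> lk lf a u v; rewrite lf lk. Qed.

End LinearCombinators.

Section Alternating.
Variables (A : comNzRingType) (n : nat).
Implicit Types (V : lmodType A) (x y z : 'rV[A]_n).

Definition wedge x y : altmap n A^o :=
  [ffun p => x 0 (p1 p) * y 0 (p2 p) - x 0 (p2 p) * y 0 (p1 p)].

Definition tilde V (h : altmap n V) (w : altmap n A^o) : V :=
  \sum_p (w p : A) *: h p.

Definition br V (h : altmap n V) x y : V := tilde h (wedge x y).

Definition jacobi (phi : altmap n 'rV[A]_n) : Prop :=
  forall x y z,
    br phi (br phi x y) z + br phi (br phi y z) x + br phi (br phi z x) y = 0.

(* phi(x,y) /\ z + phi(y,z) /\ x + phi(z,x) /\ y *)
Definition cycsum (phi : altmap n 'rV[A]_n) x y z : altmap n A^o :=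
  wedge (br phi x y) z + wedge (br phi y z) x + wedge (br phi z x) y.

Lemma wedge_linearl y : linear (wedge^~ y).
Proof.
move=> a u v; apply/ffunP=> p; rewrite !ffunE !mxE /GRing.scale /=.
by rewrite mulrBr !mulrDl !mulrA opprD addrACA.
Qed.

Lemma wedgeC x y : wedge x y = - wedge y x.
Proof. by apply/ffunP=> p; rewrite !ffunE opprB; congr (_ - _); rewrite mulrC. Qed.

Lemma wedge_linearr x : linear (wedge x).
Proof.
by move=> a u v; rewrite ![wedge x _]wedgeC wedge_linearl opprD scalerN.
Qed.

Lemma tilde_linear V (h : altmap n V) : linear (tilde h).
Proof.
move=> a u v; rewrite /tilde scaler_sumr -big_split; apply: eq_bigr => p _ /=.
by rewrite !ffunE scalerDl scalerA.
Qed.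

HB.instance Definition _ V (h : altmap n V) :=
  GRing.isLinear.Build A (altmap n A^o) V _ (tilde h) (tilde_linear h).

Lemma tilde_linear_map V (w : altmap n A^o) : linear ((@tilde V)^~ w).
Proof.
move=> a u v; rewrite /tilde scaler_sumr -big_split; apply: eq_bigr => p _ /=.
by rewrite !ffunE scalerDr !scalerA mulrC.
Qed.

Lemma wedge_delta (p q : pairs n) :
  wedge 'e_(p1 p) 'e_(p2 p) q = (q == p)%:R.
Proof.
rewrite ffunE !mxE /= -!natrM !mulnb.
have -> : (p2 q == p1 p) && (p1 q == p2 p) = false.
  apply/negP => /andP[/eqP e1 /eqP e2]; have := valP q; have := valP p.
  rewrite -/(p1 p) -/(p2 p) -/(p1 q) -/(p2 q) e1 e2 => h.
  by rewrite ltnNge ltnW.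
by rewrite subr0 -val_eqE.
Qed.

Lemma br_delta V (h : altmap n V) p : br h 'e_(p1 p) 'e_(p2 p) = h p.
Proof.
rewrite /br /tilde (bigD1 p) //= wedge_delta eqxx scale1r big1 ?addr0 // => q.
by rewrite wedge_delta => /negPf->; rewrite scale0r.
Qed.

Lemma br_linearl V (h : altmap n V) y : linear ((br h)^~ y).
Proof. by move=> a u v; rewrite /br wedge_linearl tilde_linear. Qed.

Lemma br_linearr V (h : altmap n V) x : linear (br h x).
Proof. by move=> a u v; rewrite /br wedge_linearr tilde_linear. Qed.

HB.instance Definition _ V (h : altmap n V) x :=
  GRing.isLinear.Build A 'rV[A]_n V _ (br h x) (br_linearr h x).

Lemma brC V (h : altmap n V) x y : br h x y = - br h y x.
Proof. by rewrite /br wedgeC linearN. Qed.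

Lemma br_linear_map V x y : linear (fun h : altmap n V => br h x y).
Proof. by move=> a u v; rewrite /br tilde_linear_map. Qed.

Lemma cycsumC phi x y z : cycsum phi x y z = cycsum phi y z x.
Proof. by rewrite /cycsum -addrA addrC. Qed.

Lemma cycsum_linear phi x y : linear (cycsum phi x y).
Proof.
apply: linear_addf; first apply: linear_addf.
- exact: wedge_linearr.
- by apply: (linear_compf (wedge_linearl x)); apply: br_linearr.
- by apply: (linear_compf (wedge_linearl y)); apply: br_linearl.
Qed.

HB.instance Definition _ phi x y :=
  GRing.isLinear.Build A 'rV[A]_n (altmap n A^o) _ (cycsum phi x y)
    (cycsum_linear phi x y).

End Alternating.

Section Quotients.
Variable K : fieldType.
Implicit Types vT aT rT : vectType K.

Lemma linfunE aT rT (f : aT -> rT) : linear f -> linfun f =1 f.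
Proof.
move=> lf; pose ff : {linear aT -> rT} :=
  HB.pack f (GRing.isLinear.Build _ _ _ _ f lf).
exact: (lfunE ff).
Qed.

(* The quotient U / V, realized on a complement of V in U; V <= U is intended.
   [qpi_onto] and [qpi_eq0] are its characteristic property. *)
Definition quotv vT (U V : {vspace vT}) : vectType K := subvs_of (U :\: V)%VS.

(* The class of u modulo V, for u in U. *)
Definition qpi vT (U V : {vspace vT}) : 'Hom(vT, quotv U V) :=
  (linfun (vsproj (U :\: V)) \o addv_pi1 U V)%VF.

Lemma qpi_onto vT (U V : {vspace vT}) (h : quotv U V) :
  exists2 u, u \in U & qpi U V u = h.
Proof.
exists (vsval h); first by rewrite (subvP (diffvSl U V)) ?subvsP.
rewrite comp_lfunE lfunE /= -[RHS]vsvalK; congr (vsproj _ _).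
by rewrite daddv_pi_id ?capv_diff ?subvsP.
Qed.

Lemma qpi_eq0 vT (U V : {vspace vT}) u :
  (V <= U)%VS -> u \in U -> (qpi U V u == 0) = (u \in V).
Proof.
move=> sVU uU; rewrite comp_lfunE lfunE /=.
have uUV : u \in (U + V)%VS by rewrite (addv_idPl sVU).
apply/eqP/idP => [h | uV].
  rewrite -(addv_pi1_pi2 uUV) (_ : addv_pi1 U V u = 0) ?add0r ?memv_pi2 //.
  by rewrite -(vsprojK (memv_pi (U :\: V) V u)) h.
have := addv_pi1_pi2 uUV; rewrite addv_pi2_id // -[RHS]add0r => /addIr->.
exact: linear0.
Qed.

(* The map U / V -> U' / V' induced by f, if f maps U to U' and V to V'. *)
Definition quot_map aT rT (f : 'Hom(aT, rT)) (U V : {vspace aT})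
    (U' V' : {vspace rT}) : 'Hom(quotv U V, quotv U' V') :=
  (qpi U' V' \o f \o linfun vsval)%VF.

Lemma quot_mapE aT rT (f : 'Hom(aT, rT)) U V U' V' u :
    (V <= U)%VS -> (V' <= U')%VS -> (f @: U <= U')%VS -> (f @: V <= V')%VS ->
  u \in U -> quot_map f U V U' V' (qpi U V u) = qpi U' V' (f u).
Proof.
move=> sVU sVU' fU fV uU.
rewrite 2!(comp_lfunE (_ \o _) (linfun vsval), comp_lfunE (qpi U' V') f).
rewrite (lfunE vsval) /=; set w := vsval _.
have wU : w \in U by rewrite (subvP (diffvSl U V)) ?subvsP.
have e : qpi U V w = qpi U V u.
  rewrite [in LHS]comp_lfunE lfunE /= daddv_pi_id ?capv_diff ?subvsP //.
  exact: vsvalK.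
apply/eqP; rewrite -subr_eq0 -!linearB /= qpi_eq0 //.
  apply: (subvP fV); apply: memv_img.
  by rewrite -(qpi_eq0 sVU) ?rpredB // linearB /= e subrr.
by rewrite linearB rpredB // (subvP fU) ?memv_img.
Qed.

(* f restricts to an isomorphism from U to W *)
Definition iso_on aT rT (f : 'Hom(aT, rT)) (U : {vspace aT}) (W : {vspace rT}) :=
  (lker f :&: U)%VS = 0%VS /\ (f @: U)%VS = W.

Definition dual vT : vectType K := 'Hom(vT, K^o).

End Quotients.

Section Schemes.
Variable K : fieldType.

(* A closed subscheme of the affine space of alternating maps on K^n, given by
   its functor of points on commutative K-algebras. *)
Definition scheme n := forall A : comAlgType K, altmap n 'rV[A]_n -> Prop.

Definition base_change (A : comAlgType K) n (phi : altmap n 'rV[K]_n) :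
  altmap n 'rV[A]_n := [ffun p => map_mx (in_alg A) (phi p)].

Definition schemeI n (X Y : scheme n) : scheme n := fun A x => X A x /\ Y A x.

Definition point n (X : scheme n) (phi : altmap n 'rV[K]_n) : Prop :=
  X (K^o : comAlgType K) phi.

Definition dual_numbers : comAlgType K := {poly %/ ('X^2 : {poly K})}.

Definition eps : dual_numbers := 'qX.

(* U is the Zariski tangent space of X at phi: phi + eps v is a point of X over
   the dual numbers exactly when v is in U. *)
Definition is_tangent_space n (X : scheme n) (phi : altmap n 'rV[K]_n)
    (U : {vspace altmap n 'rV[K]_n}) : Prop :=
  forall v, v \in U <->
    X dual_numbers [ffun p => base_change dual_numbers phi p
                              + eps *: base_change dual_numbers v p].

End Schemes.

Section Cochains.
Variables (K : fieldType) (n : nat).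
Notation g := 'rV[K]_n.
Implicit Types (phi f : altmap n g) (M : {vspace g}).

(* Chevalley-Eilenberg cochains of (g, phi) with values in the ideal M of g,
   on which g acts by the adjoint action. *)
Definition C1 M : {vspace 'M[K]_n} :=
  (\bigcap_i (linfun (row i : 'M[K]_n -> g) @^-1: M))%VS.

Definition C2 M : {vspace altmap n g} :=
  (\bigcap_p (linfun (fun f : altmap n g => f p) @^-1: M))%VS.

Definition d1_fun phi (L : 'M[K]_n) : altmap n g :=
  [ffun p => br phi 'e_(p1 p) ('e_(p2 p) *m L)
           - br phi 'e_(p2 p) ('e_(p1 p) *m L) - phi p *m L].

Definition d2_fun phi f : {ffun 'I_n * 'I_n * 'I_n -> g} :=
  [ffun t => let x := 'e_t.1.1 in let y := 'e_t.1.2 in let z := 'e_t.2 in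
     br phi x (br f y z) - br phi y (br f x z) + br phi z (br f x y)
   - br f (br phi x y) z + br f (br phi x z) y - br f (br phi y z) x].

Definition d1 phi := linfun (d1_fun phi).
Definition d2 phi := linfun (d2_fun phi).

Definition Z2 phi M : {vspace altmap n g} := (lker (d2 phi) :&: C2 M)%VS.
Definition B2 phi M : {vspace altmap n g} := (d1 phi @: C1 M)%VS.
Definition H2 phi M : vectType K := quotv (Z2 phi M) (B2 phi M).

Definition class2 phi M : 'Hom(altmap n g, H2 phi M) :=
  qpi (Z2 phi M) (B2 phi M).

(* The map H^2(phi, M) -> H^2(phi, phi) induced by the inclusion of M. *)
Definition i2bar phi M : 'Hom(H2 phi M, H2 phi {:g}) :=
  quot_map \1%VF (Z2 phi M) (B2 phi M) (Z2 phi {:g}) (B2 phi {:g}).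

Definition Der phi : {vspace 'M[K]_n} := lker (d1 phi).

(* A torus of derivations: commuting, diagonalizable derivations. *)
Definition is_torus phi (S : {vspace 'M[K]_n}) : Prop :=
  [/\ (S <= Der phi)%VS,
      forall D, D \in S -> diagonalizable D
    & forall D E, D \in S -> E \in S -> D *m E = E *m D].

Definition is_maximal_torus phi (S : {vspace 'M[K]_n}) : Prop :=
  is_torus phi S /\
  forall S', is_torus phi S' -> (S <= S')%VS -> S' = S.

(* The image of the third boundary map of the trivial homology complex; it is
   the T-submodule generated by the cyclic sums, see [Omega_stable]. *)
Definition Omega phi : {vspace altmap n K^o} :=
  <<[seq cycsum phi 'e_t.1.1 'e_t.1.2 'e_t.2 | t : 'I_n * 'I_n * 'I_n]>>%VS.

Definition tildeL (V : vectType K) (h : altmap n V) : 'Hom(altmap n K^o, V) :=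
  linfun (tilde h).

(* The second homology with trivial coefficients. *)
Definition HH2 phi : vectType K := quotv (lker (tildeL phi)) (Omega phi).

Definition hclass phi : 'Hom(altmap n K^o, HH2 phi) :=
  qpi (lker (tildeL phi)) (Omega phi).

Lemma cycsum_Omega phi x y z : cycsum phi x y z \in Omega phi.
Proof.
rewrite (row_sum_delta z) linear_sum rpred_sum // => k _.
rewrite linearZ rpredZ //= -cycsumC (row_sum_delta y) linear_sum rpred_sum //.
move=> j _; rewrite linearZ rpredZ //= -cycsumC (row_sum_delta x).
rewrite linear_sum rpred_sum // => i _; rewrite linearZ rpredZ //=.
by apply/memv_span/imageP; exists (j, k, i).
Qed.

Lemma mulmx_linearr (x : g) : linear (fun L : 'M[K]_n => x *m L).
Proof. by move=> a L M; rewrite mulmxDr -scalemxAr. Qed.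

Lemma d1_linear phi : linear (d1_fun phi).
Proof.
move=> a L M; apply/ffunP=> p; rewrite !ffunE; move: a L M.
apply: linear_subf; first apply: linear_subf.
- by apply: (linear_compf (br_linearr phi _)); apply: mulmx_linearr.
- by apply: (linear_compf (br_linearr phi _)); apply: mulmx_linearr.
- exact: mulmx_linearr.
Qed.

Lemma d2_linear phi : linear (d2_fun phi).
Proof.
move=> a f h; apply/ffunP=> -[[i j] k]; rewrite !ffunE /=; move: a f h.
have l1 x y z : linear (fun f => br phi x (br f y z)).
  by apply: (linear_compf (br_linearr phi x)); apply: br_linear_map.
apply: linear_subf; last exact: br_linear_map.
apply: linear_addf; last exact: br_linear_map.
apply: linear_subf; last exact: br_linear_map.
by apply: linear_addf => //; apply: linear_subf.
Qed.

Lemma C1P M L : reflect (forall i, row i L \in M) (L \in C1 M).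
Proof.
rewrite memvE; apply: (iffP subv_bigcapP) => h i => [|_].
  by move/(_ i isT): h; rewrite -memvE -memv_preim lfunE.
by rewrite -memvE -memv_preim lfunE; apply: h.
Qed.

Lemma C2P M f : reflect (forall p, f p \in M) (f \in C2 M).
Proof.
have ev p : linear (fun f : altmap n g => f p) by move=> a u v; rewrite !ffunE.
rewrite memvE; apply: (iffP subv_bigcapP) => h p => [|_].
  by move/(_ p isT): h; rewrite -memvE -memv_preim (linfunE (ev p)).
by rewrite -memvE -memv_preim (linfunE (ev p)).
Qed.

End Cochains.

Section Weights.
Variables (K : fieldType) (T : vectType K) (alpha : nat -> dual T).

(* The weight space of weight a of the action rho of T; for a linear rho,
   quantifying over a basis of T amounts to quantifying over T, see [wspaceP]. *)
Definition wspace (V : vectType K) (rho : T -> 'End(V)) (a : dual T) :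
    {vspace V} :=
  (\bigcap_(i < \dim {:T})
     lker (rho (vbasis {:T})`_i - (a (vbasis {:T})`_i : K) *: \1%VF))%VS.

Lemma wspaceP (V : vectType K) (rho : T -> 'End(V)) (a : dual T) v :
  linear rho -> (v \in wspace rho a) <-> (forall t, rho t v = (a t : K) *: v).
Proof.
move=> lrho; rewrite memvE; split=> [/subv_bigcapP h t | h].
  have {}h i (ti := (vbasis {:T})`_i) : (i < \dim {:T})%N ->
      rho ti v = (a ti : K) *: v.
    move=> lti; move/(_ (Ordinal lti) isT): h.
    rewrite -memvE memv_ker add_lfunE opp_lfunE scale_lfunE id_lfunE.
    by rewrite subr_eq0 => /eqP.
  pose rl : {linear T -> 'End(V)} :=
    HB.pack rho (GRing.isLinear.Build _ _ _ _ rho lrho).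
  rewrite (coord_vbasis (memvf t)) -[rho _]/(rl _) !linear_sum sum_lfunE.
  rewrite scaler_suml; apply: eq_bigr => i _.
  by rewrite !linearZ scale_lfunE /= h // scalerA.
apply/subv_bigcapP => i _; rewrite -memvE memv_ker add_lfunE opp_lfunE.
by rewrite scale_lfunE id_lfunE h subrr.
Qed.

Section Actions.
Variable n : nat.
Notation g := 'rV[K]_n.

(* The matrix of t acting on K^n. *)
Definition tor (t : T) : 'M[K]_n := diag_mx (\row_i (alpha i t : K)).

Definition torus : {vspace 'M[K]_n} := limg (linfun tor).

(* T acts on 'M[K]_n = Hom(K^n, K^n), on Hom(wedge^2 K^n, K^n) and on
   wedge^2 K^n. *)
Definition act1 (t : T) : 'End('M[K]_n) :=
  linfun (fun L => L *m tor t - tor t *m L).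

Definition act2 (t : T) : 'End(altmap n g) :=
  linfun (fun f : altmap n g => [ffun p : pairs n =>
    f p *m tor t - br f ('e_(p1 p) *m tor t) 'e_(p2 p)
                 - br f 'e_(p1 p) ('e_(p2 p) *m tor t)] : altmap n g).

Definition actw (t : T) : 'End(altmap n K^o) :=
  tildeL [ffun p : pairs n =>
    wedge ('e_(p1 p) *m tor t) 'e_(p2 p) + wedge 'e_(p1 p) ('e_(p2 p) *m tor t)].

Definition Z2T (phi : altmap n g) M := (Z2 phi M :&: wspace act2 0)%VS.
Definition B2T (phi : altmap n g) M := (B2 phi M :&: wspace act2 0)%VS.

(* H^2(phi, M)^T, as a subspace of H^2(phi, M) *)
Definition H2T (phi : altmap n g) M : {vspace H2 phi M} :=
  wspace (fun t => quot_map (act2 t) (Z2 phi M) (B2 phi M) (Z2 phi M) (B2 phi M))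
         0.

(* The weight space of weight a in the homology space H_2(phi). *)
Definition HH2w (phi : altmap n g) (a : dual T) : {vspace HH2 phi} :=
  wspace (fun t => quot_map (actw t) (lker (tildeL phi)) (Omega phi)
                                     (lker (tildeL phi)) (Omega phi)) a.

(* The scheme of T-invariant Lie laws on K^n. *)
Definition LT : scheme K n := fun A x =>
  (forall p (k : 'I_n), alpha (p1 p) + alpha (p2 p) != alpha k -> x p 0 k = 0)
  /\ jacobi x.

(* The set Sigma_n(T). *)
Definition Sigma (phi : altmap n g) : Prop :=
  point LT phi /\ is_maximal_torus phi torus.

(* (p, k) with p = (i, j) stands for the multi-index k over ij. *)
Definition multi_index : finType := (pairs n * 'I_n)%type.

Definition Jset : {set multi_index} :=
  [set a : multi_index | alpha (p1 a.1) + alpha (p2 a.1) == alpha a.2].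

Definition C1T : {vspace 'M[K]_n} := (C1 {:g} :&: wspace act1 0)%VS.

(* The linear form L |-> (d_phi L)^a on C^1(K^n, K^n)^T. *)
Definition dform (phi : altmap n g) (a : multi_index) : dual (subvs_of C1T) :=
  linfun (fun L : subvs_of C1T => d1 phi (vsval L) a.1 0 a.2 : K^o).

Definition admissible (phi : altmap n g) (A : {set multi_index}) : Prop :=
  minset (fun A : {set multi_index} => (A \subset Jset) &&
    (\dim <<[seq dform phi a | a in A]>>%VS == \dim (B2T phi {:g}))) A.

(* The closed subscheme of LT where the coordinates indexed by A are 1. *)
Definition LTA (A : {set multi_index}) : scheme K n := fun B x =>
  LT x /\ forall a, a \in A -> x a.1 0 a.2 = 1.

Lemma wedge_tor t (x y : g) :
  wedge (x *m tor t) y + wedge x (y *m tor t) =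
  [ffun p => ((alpha (p1 p) t : K) + (alpha (p2 p) t : K)) * wedge x y p].
Proof.
apply/ffunP=> p; rewrite !ffunE !mul_mx_diag !mxE.
have id6 (a b u v w z : K) : u * a * z - v * b * w + (u * (z * b) - v * (w * a))
    = (a + b) * (u * z - v * w) by ring.
exact: id6.
Qed.

Lemma br_tor (phi : altmap n g) t x y : point LT phi ->
  br phi x y *m tor t = br phi (x *m tor t) y + br phi x (y *m tor t).
Proof.
case=> inv _; rewrite /br -linearD wedge_tor /tilde mulmx_suml.
apply: eq_bigr => p _; rewrite -scalemxAl ffunE; apply/rowP=> k.
rewrite mul_mx_diag !mxE.
have [e | /inv ->] := eqVneq (alpha (p1 p) + alpha (p2 p)) (alpha k).
  have id4 (a b u v : K) : u * (v * (a + b)) = (a + b) * u * v by ring.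
  rewrite -e add_lfunE [in RHS]ffunE [in RHS]ffunE; exact: id4.
by rewrite mul0r !mulr0.
Qed.

Lemma actw_wedge t (x y : g) :
  actw t (wedge x y) = wedge (x *m tor t) y + wedge x (y *m tor t).
Proof.
rewrite /actw /tildeL lfunE /= wedge_tor; apply/ffunP=> q; set h := finfun _.
pose c (p : pairs n) : K := (alpha (p1 p) t : K) + (alpha (p2 p) t : K).
have e p : (wedge x y p : K) *: h p = [ffun q => c p * wedge x y p *+ (q == p)]
    :> altmap n K^o.
  rewrite [h p]ffunE wedge_tor; apply/ffunP=> q'; rewrite !ffunE.
  have := wedge_delta K p q'; rewrite ffunE => ->; rewrite /c.
  have [->|_] := eqVneq q' p; last by rewrite !mulr0 mulr0n; exact: mulr0.
  rewrite mulr1 mulr1n; exact: mulrC.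
rewrite /tilde sum_ffunE (bigD1 q) //= big1 => [|p pq].
  by rewrite addr0 e [LHS]ffunE [RHS]ffunE eqxx.
by rewrite e ffunE eq_sym (negPf pq).
Qed.

Lemma Omega_stable (phi : altmap n g) t :
  point LT phi -> (actw t @: Omega phi <= Omega phi)%VS.
Proof.
move=> Tphi; rewrite limg_span; apply/span_subvP=> _ /mapP[_ /imageP[s _ ->] ->].
set x := delta_mx _ _; set y := delta_mx _ _; set z := delta_mx _ _.
rewrite (_ : _ (cycsum _ _ _ _) = cycsum phi (x *m tor t) y z +
  cycsum phi x (y *m tor t) z + cycsum phi x y (z *m tor t)).
  by apply: rpredD; [apply: rpredD|]; apply: cycsum_Omega.
rewrite /cycsum !linearD /= !actw_wedge !br_tor //.
have wl u v w : wedge (u + v) w = wedge u w + wedge v w :> altmap n K^o.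
  by have := wedge_linearl w 1 u v; rewrite !scale1r.
rewrite !wl /cycsum; apply/ffunP=> q; rewrite !ffunE.
have id9 (a b c d e f h k l : K) : a + b + c + (d + e + f) + (h + k + l)
  = a + f + k + (b + d + l) + (c + e + h) by ring.
exact: id9.
Qed.

End Actions.

Definition path_of_weights (n0 N : nat) : Prop :=
  [/\ <<mkseq alpha n0>>%VS = {:dual T}%VS,
      exists t, forall i, (i < n0)%N ->
        exists2 q : rat, (0 < q)%R & alpha i t = ratr q,
      forall n, (n0 <= n <= N)%N -> exists phi : altmap n 'rV[K]_n, Sigma phi
    & forall n, (n0 <= n < N)%N -> forall i j, (i < n)%N -> (j < n)%N ->
        alpha n != alpha i - alpha j].

(* alpha 0, ..., alpha (N - 1) is (the beginning of) a simple path of weights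
   with initialization n0. *)
Definition simple_path (n0 N : nat) : Prop :=
  path_of_weights n0 N /\ uniq (mkseq alpha N).

Section Extension.
Variable n : nat.
Notation g := 'rV[K]_n.
Notation g1 := 'rV[K]_n.+1.

(* Forgetting the coordinates involving 'e_ord_max, for any coefficients. *)
Definition forget (A : comNzRingType) (x : altmap n.+1 'rV[A]_n.+1) :
  altmap n 'rV[A]_n := [ffun p => \row_k x (wpair p) 0 (wid k)].

(* The scheme-theoretic fibre over phi of the morphism forget. *)
Definition fibre (phi : altmap n g) : scheme K n.+1 := fun A x =>
  LT x /\ forget x = base_change A phi.

Definition Ke : {vspace g1} := <['e_ord_max]>%VS.

(* The restriction to K^n x K^n of a map on K^(n+1). *)
Definition restr (f : altmap n.+1 g1) : altmap n g1 :=
  [ffun p => f (wpair p)].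

(* The cocycle psi such that phi1 = forget phi1 + psi. *)
Definition psi (phi1 : altmap n.+1 g1) : altmap n g1 :=
  [ffun p => restr phi1 p 0 ord_max *: 'e_ord_max].

(* The extension of f by zero on K^(n+1) x K e_ord_max. *)
Definition ext0 (f : altmap n g1) : altmap n.+1 g1 :=
  [ffun q => if [pick p | wpair p == q] is Some p then f p else 0].

Definition nontrivial_central_extension (phi : altmap n g)
    (phi1 : altmap n.+1 g1) : Prop :=
  [/\ forget phi1 = phi, forall x, br phi1 x 'e_ord_max = 0
    & ~ exists l : dual g, forall p, phi1 (wpair p) 0 ord_max = l (phi p)].

Definition wmulti (a : multi_index n) : multi_index n.+1 :=
  (wpair a.1, wid a.2).

Definition direct_filiation (A : {set multi_index n})
    (A1 : {set multi_index n.+1}) : Prop :=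
  [/\ (#|A| + \dim {:T})%N = n, (#|A1| + \dim {:T})%N = n.+1,
      exists p : pairs n.+1, A1 = (p, ord_max) |: wmulti @: A
    & exists phi : altmap n g, exists phi1 : altmap n.+1 g1,
      [/\ Sigma phi, Sigma phi1, nontrivial_central_extension phi phi1,
          admissible phi A & admissible phi1 A1]].

(* Numerator and denominator of the hyperplane
   ((ker phi~)_a /\ ker psi~) / Omega(phi)_a of H_2(phi)_a. *)
Definition hyp_num (phi : altmap n g) (phi1 : altmap n.+1 g1) (a : dual T) :
  {vspace altmap n K^o} :=
  (lker (tildeL phi) :&: wspace (@actw n) a :&: lker (tildeL (psi phi1)))%VS.

Definition hyp_den (phi : altmap n g) (a : dual T) : {vspace altmap n K^o} :=
  (Omega phi :&: wspace (@actw n) a)%VS.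

End Extension.
End Weights.

Arguments Ke K n : clear implicits.

(* Main.v *)
(* The weights are distinct, so T acts on matrices, on alternating maps and on
   the exterior square with the standard bases as weight vectors, and the weight
   projections, being polynomials in the action, pass to Z^2, B^2, Omega and
   their quotients.
   All weights are positive rationals at a common t: a weight alpha_m that is
   not the sum of two earlier ones would make E_mm a derivation enlarging the
   maximal torus.  Hence the new vector e is central, an invariant cochain with
   values in K e is a linear form on (/\^2 K^n)_{alpha_{n+1}}, a space contained
   in ker phi~, and it is a cocycle exactly when this form kills Omega(phi).
   This gives the tangent space of the fibre and its duality with homology.
   The forms l |-> l_i + l_j - l_k indexed by a minimal admissible set are
   linearly independent, and for |A| = n - r their common kernel on diagonal
   matrices is the torus.  So the coboundaries d(diag l) supplement the slice
   X^k_ij = 1; those with values in K e are multiples of psi' = - d(E_ee), a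
   line which the coordinate of A_(n+1) outside A_n cuts transversally. *)

Require Import Defs.
From HB Require Import structures.
From mathcomp Require Import all_boot all_order all_algebra.
From mathcomp Require Import ring.

Set Implicit Arguments.
Unset Strict Implicit.
Unset Printing Implicit Defensive.

Import Order.TTheory GRing.Theory Num.Theory.
Local Open Scope ring_scope.

(** * Weight projections *)

Section WeightProjection.
Variables (K : fieldType) (T E : vectType K) (rho : T -> 'End(E)).
Variables (I : finType) (w : I -> dual T) (c : I -> E -> K).
Hypothesis clin : forall i, linear (c i : E -> K^o).
Hypothesis c_inj : forall u v, (forall i, c i u = c i v) -> u = v.
Hypothesis rhoE : forall t u i, c i (rho t u) = (w i t : K) * c i u.

Lemma coordZ i a u : c i (a *: u) = a * c i u.
Proof.
have c0 : c i 0 = 0.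
  by have := clin i (-1) 0 0; rewrite scaleN1r addNr => ->; rewrite /GRing.scale /= mulN1r addNr.
by have := clin i a u 0; rewrite !addr0 c0 addr0.
Qed.

Lemma coordD i u v : c i (u + v) = c i u + c i v.
Proof. by have := clin i 1 u v; rewrite scale1r /GRing.scale /= mul1r. Qed.

Lemma coordB i u v : c i (u - v) = c i u - c i v.
Proof. by rewrite coordD -scaleN1r coordZ mulN1r. Qed.

Lemma weight_action_linear : linear rho.
Proof.
move=> a s t; apply/lfunP=> u; apply: c_inj => i.
rewrite add_lfunE scale_lfunE coordD coordZ !rhoE linearP mulrDl.
by rewrite -mulrA.
Qed.

Lemma wspace_coord (a : dual T) u :
  (u \in wspace rho a) <-> (forall i, w i != a -> c i u = 0).
Proof.
rewrite wspaceP; last exact: weight_action_linear.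
split=> [h i ne | h t].
  apply/eqP; apply: contraNT ne => nz; apply/eqP/lfunP=> t.
  by apply: (mulIf nz); rewrite -rhoE h coordZ.
apply: c_inj => i; rewrite rhoE coordZ.
by have [-> //|/h->] := eqVneq (w i) a; rewrite !mulr0.
Qed.

(* On each coordinate of weight different from [a] the projection picks some t
   separating the two weights, so it is a polynomial in the [rho t]: this is why
   it preserves all the stable subspaces. *)
Lemma weight_projection (a : dual T) : exists P : 'End(E),
  [/\ forall u i, c i (P u) = (w i == a)%:R * c i u,
      forall S : {vspace E}, (forall t, (rho t @: S <= S)%VS) -> (P @: S <= S)%VS
    & forall (S : {vspace E}) u, (forall t, (rho t @: S <= S)%VS) ->
        (forall t, rho t u - (a t : K) *: u \in S) -> P u - u \in S].
Proof.
suff [P [Pa Pc P1 P2]] : exists P : 'End(E),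
  [/\ forall u i, w i = a -> c i (P u) = c i u,
      forall u i, w i != a -> i \in enum I -> c i (P u) = 0,
      forall S : {vspace E}, (forall t, (rho t @: S <= S)%VS) -> (P @: S <= S)%VS
    & forall (S : {vspace E}) u, (forall t, (rho t @: S <= S)%VS) ->
        (forall t, rho t u - (a t : K) *: u \in S) -> P u - u \in S].
  exists P; split=> // u i; have [/Pa->|/Pc->] := eqVneq (w i) a.
  - by rewrite mul1r.
  - by rewrite mul0r.
  - by rewrite mem_enum.
(* The projection is built as a product with one factor per coordinate to be killed; all factors fix
   the coordinates of weight [a]. *)
elim: (enum I) => [|q s [P [Pa Pc P1 P2]]].
  exists \1%VF; split=> [u i _|//|S _|S u _ _].
  - by rewrite id_lfunE.
  - by rewrite lim1g.
  - by rewrite id_lfunE subrr mem0v.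
have [qa|qa] := eqVneq (w q) a.
  exists P; split=> // u i ne; rewrite inE => /orP[/eqP e|]; last exact: Pc.
  by rewrite e qa eqxx in ne.
(* For [t] separating [w q] from [a], the factor [(rho t - w q t) / (a t - w q t)] kills the
   coordinate [q] and is the identity on weight [a]. *)
have /lfunPn[t nt] := qa; pose k : K := (a t - w q t)^-1.
have kn : k * (a t - w q t : K) = 1 by rewrite mulVf // subr_eq0 eq_sym.
exists ((k *: (rho t - (w q t : K) *: \1%VF)) \o P)%VF.
have Qe u : (k *: (rho t - (w q t : K) *: \1%VF))%VF u
    = k *: (rho t u - (w q t : K) *: u).
  by rewrite scale_lfunE add_lfunE opp_lfunE scale_lfunE id_lfunE.
split=> [u i wi | u i wi | S st | S u st su].
- by rewrite comp_lfunE Qe coordZ coordB coordZ rhoE wi Pa // -mulrBl mulrA kn mul1r.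
- rewrite comp_lfunE Qe coordZ coordB coordZ rhoE inE => /orP[/eqP->|/(Pc u i wi)->].
    by rewrite subrr mulr0.
  by rewrite !mulr0 subrr mulr0.
- rewrite limg_comp; apply: (subv_trans (limgS _ (P1 S st))).
  apply/subvP=> _ /memv_imgP[u uS ->]; rewrite Qe rpredZ // rpredB ?rpredZ //.
  by rewrite (subvP (st t)) ?memv_img.
(* With [Q] the new factor, [Q (P u) - u = Q (P u - u) + (Q u - u)]: the first term is in [S] by
   stability, the second is a multiple of [rho t u - a t *: u]. *)
rewrite comp_lfunE -{1}(subrK u (P u)) linearD -addrA /=; apply: rpredD.
  rewrite Qe; move: (P2 S u st su) => h; rewrite rpredZ // rpredB ?rpredZ //.
  by rewrite (subvP (st t)) ?memv_img.
rewrite Qe -[X in _ - X]scale1r -kn -scalerA -scalerBr.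
by rewrite rpredZ // scalerBl opprB addrA subrK.
Qed.

(** Weight spaces commute with quotients: a lift [u] of a class of weight [a] is an eigenvector
    modulo [V], so its projection [P u] is a genuine weight vector with the same class. *)
Lemma weight_space_quot (a : dual T) (U V : {vspace E}) :
  (V <= U)%VS -> (forall t, (rho t @: U <= U)%VS) ->
  (forall t, (rho t @: V <= V)%VS) ->
  wspace (fun t => quot_map (rho t) U V U V) a
  = (qpi U V @: (U :&: wspace rho a))%VS.
Proof.
move=> sVU sU sV.
have lq : linear (fun t => quot_map (rho t) U V U V).
  move=> b s t; rewrite /quot_map weight_action_linear.
  by rewrite comp_lfunDr comp_lfunDl -comp_lfunZr -comp_lfunZl.
apply/vspaceP=> h; apply/idP/memv_imgP => [/(wspaceP _ _ lq) hh|[u]].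
  have [u uU hu] := qpi_onto h.
  have [P [Pc P1 P2]] := weight_projection a.
  have ru t : rho t u \in U by rewrite (subvP (sU t)) ?memv_img.
  have su t : rho t u - (a t : K) *: u \in V.
    rewrite -(qpi_eq0 sVU) ?rpredB ?rpredZ //.
    by rewrite linearB linearZ /= -(quot_mapE sVU sVU (sU t) (sV t)) // hu hh subrr.
  have Pu := P2 V u sV su.
  exists (P u); last first.
    rewrite -hu; apply/eqP; rewrite -subr_eq0 -linearB /= qpi_eq0 //.
      by rewrite -opprB rpredN.
    by rewrite rpredB // (subvP (P1 U sU)) ?memv_img.
  rewrite memv_cap (subvP (P1 U sU)) ?memv_img //; apply/wspace_coord=> i ne.
  by rewrite Pc (negPf ne) mul0r.
rewrite memv_cap => /andP[uU /(wspaceP _ _ weight_action_linear) ua] ->.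
apply/(wspaceP _ _ lq) => t.
by rewrite (quot_mapE sVU sVU (sU t) (sV t)) // ua linearZ.
Qed.

End WeightProjection.

(** * Cocycles and the torus action *)

Section BracketLinearity.
Variables (A : comNzRingType) (n : nat) (V : lmodType A) (h : altmap n V).
Implicit Types (x y : 'rV[A]_n).

Lemma brZl a x y : br h (a *: x) y = a *: br h x y.
Proof. by rewrite brC linearZ -scalerN -brC. Qed.

Lemma brNl x y : br h (- x) y = - br h x y.
Proof. by rewrite -[- x]scaleN1r brZl scaleN1r. Qed.

Lemma brDl x x' y : br h (x + x') y = br h x y + br h x' y.
Proof. by have := br_linearl h y 1 x x'; rewrite !scale1r. Qed.

Lemma brBl x x' y : br h (x - x') y = br h x y - br h x' y.
Proof. by rewrite brDl brNl. Qed.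

End BracketLinearity.

(** Cyclic symmetry reduces trilinearity to linearity in the last argument: expand it on the basis,
    rotate, and repeat three times. *)
Lemma eq0_on_basis (A : comNzRingType) n (V : lmodType A)
    (G : 'rV[A]_n -> 'rV[A]_n -> 'rV[A]_n -> V) :
  (forall x y, linear (G x y)) -> (forall x y z, G x y z = G y z x) ->
  (forall i j k, G 'e_i 'e_j 'e_k = 0) -> forall x y z, G x y z = 0.
Proof.
move=> Gl GC.
(* [P] and [Q] record which of the first two arguments are already basis vectors. *)
suff ext (P Q : 'rV[A]_n -> Prop) : (forall x y i, P x -> Q y -> G x y 'e_i = 0) ->
    forall x y z, P x -> Q y -> G x y z = 0.
  move=> G0 x y z.
  apply: (ext (fun=> True) (fun=> True)) => // {}x {}y k _ _; rewrite -GC.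
  apply: (ext (fun u => exists k, u = 'e_k) (fun=> True)) => // [|]; last by exists k.
  move=> _ {}y j [{}k ->] _; rewrite -GC.
  apply: (ext (fun u => exists j, u = 'e_j) (fun u => exists k, u = 'e_k)) => //.
  - by move=> _ _ i [{}j ->] [{}k ->]; rewrite -GC.
  - by exists j.
  - by exists k.
move=> G0 x y z Px Qy.
pose f : {linear 'rV[A]_n -> V} :=
  HB.pack (G x y) (GRing.isLinear.Build _ _ _ _ (G x y) (Gl x y)).
rewrite -[G x y z]/(f z) (row_sum_delta z) linear_sum big1 // => i _.
by rewrite linearZ /= G0 ?scaler0.
Qed.

Section LinearizedJacobi.
Variables (A : comNzRingType) (n : nat).
Implicit Types (phi f : altmap n 'rV[A]_n) (x y z : 'rV[A]_n).

(* The polarization of the Jacobi identity, which is [- d2] over a field. *)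
Definition jac2 phi f x y z : 'rV[A]_n :=
  tilde phi (cycsum f x y z) + tilde f (cycsum phi x y z).

Lemma jacobi_cycsum phi x y z :
  br phi (br phi x y) z + br phi (br phi y z) x + br phi (br phi z x) y
  = tilde phi (cycsum phi x y z).
Proof. by rewrite /cycsum !linearD. Qed.

Lemma cycsum_linear_map x y z : linear (fun f : altmap n 'rV[A]_n => cycsum f x y z).
Proof.
by apply: linear_addf; first apply: linear_addf;
  apply: (linear_compf (k := (@wedge A n)^~ _)); apply: wedge_linearl || apply: br_linear_map.
Qed.

Lemma jacobi_on_basis phi :
  (forall i j k, tilde phi (cycsum phi 'e_i 'e_j 'e_k) = 0) -> jacobi phi.
Proof.
move=> h x y z; rewrite jacobi_cycsum.
apply: (eq0_on_basis (G := fun x y z => tilde phi (cycsum phi x y z))) => //.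
- by move=> {}x {}y; apply: linear_compf; [apply: tilde_linear|apply: cycsum_linear].
- by move=> {}x {}y {}z; rewrite cycsumC.
Qed.

End LinearizedJacobi.

Section Cocycles.
Variables (K : fieldType) (n : nat).
Implicit Types (phi f : altmap n 'rV[K]_n) (M : {vspace 'rV[K]_n}).

Lemma d2_jac2 phi f i j k : d2 phi f (i, j, k) = - jac2 phi f 'e_i 'e_j 'e_k.
Proof.
rewrite /d2 (linfunE (d2_linear phi)) ffunE /= /jac2 /cycsum !linearD /= -!/(br _ _ _).
set x := 'e_i; set y := 'e_j; set z := 'e_k.
rewrite (brC phi x (br f y z)) (brC phi y (br f x z)) (brC phi z (br f x y)).
rewrite (brC f x z) (brC phi x z) !brNl.
apply/rowP=> m; rewrite !mxE; ring.
Qed.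

Lemma lker_d2P phi f :
  (f \in lker (d2 phi)) <-> (forall i j k, jac2 phi f 'e_i 'e_j 'e_k = 0).
Proof.
rewrite memv_ker; split=> [/eqP h i j k | h].
  by apply: oppr_inj; rewrite -d2_jac2 h ffunE oppr0.
by apply/eqP/ffunP=> -[[i j] k]; rewrite d2_jac2 h ffunE oppr0.
Qed.

Lemma delta_diag (l : 'rV[K]_n) i :
  ('e_i : 'rV[K]_n) *m diag_mx l = l 0 i *: 'e_i.
Proof.
apply/rowP=> m; rewrite mul_mx_diag !mxE /= mulrC.
by case: (m =P i) => [->|_] //; rewrite !mulr0.
Qed.

(** A diagonal cochain merely rescales each coordinate of the law. All later comparisons of
    coboundaries with slices and with the torus rest on this formula. *)
Lemma d1_diag phi (l : 'rV[K]_n) p k :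
  d1 phi (diag_mx l) p 0 k = (l 0 (p1 p) + l 0 (p2 p) - l 0 k) * phi p 0 k.
Proof.
rewrite /d1 (linfunE (d1_linear phi)) ffunE !delta_diag !linearZ /= (brC phi 'e_(p2 p)).
rewrite br_delta mul_mx_diag !mxE; ring.
Qed.

End Cocycles.

Section InvariantCochains.
Variables (K : fieldType) (T : vectType K) (alpha : nat -> dual T) (n : nat).
Implicit Types (phi f : altmap n 'rV[K]_n) (M : {vspace 'rV[K]_n}).

Lemma delta_tor t (i : 'I_n) :
  ('e_i : 'rV[K]_n) *m tor alpha n t = (alpha i t : K) *: 'e_i.
Proof. by rewrite delta_diag mxE. Qed.

Lemma br_act2 t f x y : br (act2 alpha n t f) x y =
  br f x y *m tor alpha n t - br f (x *m tor alpha n t) y - br f x (y *m tor alpha n t).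
Proof.
have lin : linear (fun f : altmap n 'rV[K]_n => [ffun p : pairs n =>
    f p *m tor alpha n t - br f ('e_(p1 p) *m tor alpha n t) 'e_(p2 p)
      - br f 'e_(p1 p) ('e_(p2 p) *m tor alpha n t)] : altmap n 'rV[K]_n).
  move=> a u v; apply/ffunP=> p; rewrite !ffunE mulmxDl -scalemxAl !br_linear_map.
  by apply/rowP=> k; rewrite !mxE; ring.
rewrite -addrA -opprD /br -linearD wedge_tor /act2 (linfunE lin) /tilde.
rewrite mulmx_suml -sumrB; apply: eq_bigr => p _.
rewrite [X in _ *: X = _]ffunE !delta_tor linearZ /= brZl br_delta [X in _ = _ - X *: _]ffunE.
apply/rowP=> k; move: (wedge x y p : K) => b; rewrite !mul_mx_diag !mxE.
have id5 (u v c d e : K) : u * (v * c - d * v - e * v) = u * v * c - (d + e) * u * v by ring.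
exact: id5.
Qed.

Lemma act2E t f p k : act2 alpha n t f p 0 k =
  ((alpha k t : K) - alpha (p1 p) t - alpha (p2 p) t) * f p 0 k.
Proof.
rewrite -(br_delta (act2 _ _ _ _)) br_act2 !delta_tor linearZ /= brZl.
rewrite br_delta mul_mx_diag !mxE; ring.
Qed.

Definition wt2 (q : pairs n * 'I_n) : dual T :=
  alpha q.2 - alpha (p1 q.1) - alpha (p2 q.1).

Lemma wt2E t f q : act2 alpha n t f q.1 0 q.2 = (wt2 q t : K) * f q.1 0 q.2.
Proof. by rewrite act2E /wt2 !add_lfunE !opp_lfunE. Qed.

Lemma alt_coord_linear (q : pairs n * 'I_n) :
  linear (fun f : altmap n 'rV[K]_n => f q.1 0 q.2 : K^o).
Proof. by move=> a u v; rewrite !ffunE !mxE. Qed.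

Lemma alt_coord_inj f (h : altmap n 'rV[K]_n) : (forall q : pairs n * 'I_n, f q.1 0 q.2 = h q.1 0 q.2) -> f = h.
Proof. by move=> e; apply/ffunP=> p; apply/rowP=> k; apply: (e (p, k)). Qed.

(** T-invariance of a cochain in coordinates, in the form in which [LT] imposes it on laws. *)
Definition inv2 f := forall p (k : 'I_n),
  alpha (p1 p) + alpha (p2 p) != alpha k -> f p 0 k = 0.

Lemma inv2P f : (f \in wspace (act2 alpha n) 0) <-> inv2 f.
Proof.
rewrite (wspace_coord alt_coord_linear alt_coord_inj wt2E).
have e q : (wt2 q != 0) = (alpha (p1 q.1) + alpha (p2 q.1) != alpha q.2).
  by rewrite /wt2 -addrA -opprD subr_eq0 eq_sym.
by split=> [h p k ne|h q]; [apply: (h (p, k)); rewrite e|rewrite e; apply: h].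
Qed.

Lemma act1_C1 t M L : (forall m, m \in M -> m *m tor alpha n t \in M) ->
  L \in C1 M -> L *m tor alpha n t - tor alpha n t *m L \in C1 M.
Proof.
move=> st /C1P h; apply/C1P=> i; rewrite linearB /= !row_mul.
have -> : row i (tor alpha n t) *m L = (alpha i t : K) *: row i L.
  by rewrite rowE delta_tor -scalemxAl -rowE.
by rewrite rpredB ?rpredZ ?st.
Qed.

Section Law.
Variable phi : altmap n 'rV[K]_n.
Hypothesis phiT : point (LT alpha (n := n)) phi.

(** T acts by derivations of [phi] ([br_tor]), so the differential is equivariant. *)
Lemma act2_d1 t L : act2 alpha n t (d1 phi L) =
  d1 phi (L *m tor alpha n t - tor alpha n t *m L).
Proof.
apply/ffunP=> p; rewrite -[LHS]br_delta br_act2 !delta_tor linearZ /=.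
rewrite brZl br_delta.
rewrite /d1 !(linfunE (d1_linear phi)) !ffunE !mulmxBr !mulmxA !delta_tor.
rewrite -!scalemxAl !linearB !linearZ /=.
set u := 'e_(p2 p) *m L; set v := 'e_(p1 p) *m L.
have h x y : br phi x (y *m tor alpha n t) =
    br phi x y *m tor alpha n t - br phi (x *m tor alpha n t) y.
  by rewrite br_tor // addrC addKr.
rewrite !h !delta_tor !brZl.
have -> : phi p *m tor alpha n t = (alpha (p1 p) t + alpha (p2 p) t : K) *: phi p.
  rewrite -[phi p]br_delta br_tor // !delta_tor linearZ /= brZl.
  by rewrite scalerDl.
rewrite !mulmxBl -!scalemxAl.
apply/rowP=> k; rewrite !mxE; ring.
Qed.

Lemma act2_Z2 t M : (forall m, m \in M -> m *m tor alpha n t \in M) ->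
  (act2 alpha n t @: Z2 phi M <= Z2 phi M)%VS.
Proof.
move=> st; apply/subvP=> _ /memv_imgP[f + ->]; rewrite !memv_cap => /andP[/lker_d2P Zf /C2P Mf].
have brM i j : br f 'e_i 'e_j \in M.
  by rewrite /br /tilde rpred_sum // => p _; rewrite rpredZ.
apply/andP; split; last first.
  apply/C2P=> p; rewrite -(br_delta (act2 _ _ _ _)) br_act2 !delta_tor brZl !linearZ /=.
  by rewrite !rpredD ?rpredZ ?rpredN ?st.
apply/lker_d2P=> i j k.
(* The map [jac2 phi] is equivariant too; [e1] and [e2] check this for the two kinds of terms, with
   the law applied last and with the cochain applied last. *)
have -> : jac2 phi (act2 alpha n t f) 'e_i 'e_j 'e_k =
  jac2 phi f 'e_i 'e_j 'e_k *m tor alpha n t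
  - (alpha i t + alpha j t + alpha k t : K) *: jac2 phi f 'e_i 'e_j 'e_k.
  have e1 a b c : br phi (br (act2 alpha n t f) 'e_a 'e_b) 'e_c =
      br phi (br f 'e_a 'e_b) 'e_c *m tor alpha n t
      - (alpha a t + alpha b t + alpha c t : K) *: br phi (br f 'e_a 'e_b) 'e_c.
    rewrite br_act2 !delta_tor linearZ /= brZl !brBl !brZl.
    have h u : br phi (u *m tor alpha n t) 'e_c =
        br phi u 'e_c *m tor alpha n t - (alpha c t : K) *: br phi u 'e_c.
      by rewrite (br_tor t u 'e_c phiT) delta_tor linearZ addrK.
    rewrite h; apply/rowP=> m; rewrite !mxE; ring.
  have e2 a b c : br (act2 alpha n t f) (br phi 'e_a 'e_b) 'e_c =
      br f (br phi 'e_a 'e_b) 'e_c *m tor alpha n t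
      - (alpha a t + alpha b t + alpha c t : K) *: br f (br phi 'e_a 'e_b) 'e_c.
    rewrite br_act2 (br_tor t _ _ phiT) !delta_tor !linearZ /= !brZl -scalerDl brZl.
    apply/rowP=> m; rewrite !mxE; ring.
  rewrite /jac2 /cycsum !linearD /= -!/(br _ _ _) !e1 !e2 !mulmxDl.
  apply/rowP=> m; rewrite !mxE; ring.
by rewrite Zf // mul0mx scaler0 subrr.
Qed.

End Law.
End InvariantCochains.

(** * Dual numbers *)

Section BaseChange.
Variables (K : fieldType) (A : comAlgType K) (n : nat).
Notation iota := (in_alg A).

Definition base_ext (w : altmap n K^o) : altmap n A^o := [ffun p => iota (w p : K)].

Lemma wedge_base (x y : 'rV[K]_n) :
  wedge (map_mx iota x) (map_mx iota y) = base_ext (wedge x y).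
Proof. by apply/ffunP=> p; rewrite !ffunE !mxE rmorphB !rmorphM. Qed.

Lemma tilde_base (f : altmap n 'rV[K]_n) w :
  tilde (base_change A f) (base_ext w) = map_mx iota (tilde f w).
Proof.
rewrite /tilde (raddf_sum (map_mx iota)); apply: eq_bigr => p _.
rewrite !ffunE; apply/rowP=> k; rewrite !mxE.
by rewrite -[RHS]/(in_alg A _) -(rmorphM (in_alg A)).
Qed.

Lemma br_base (f : altmap n 'rV[K]_n) x y :
  br (base_change A f) (map_mx iota x) (map_mx iota y) = map_mx iota (br f x y).
Proof. by rewrite /br wedge_base tilde_base. Qed.

Lemma base_extD w w' : base_ext (w + w') = base_ext w + base_ext w'.
Proof. by apply/ffunP=> p; rewrite !ffunE rmorphD. Qed.

Lemma cycsum_base (f : altmap n 'rV[K]_n) x y z :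
  cycsum (base_change A f) (map_mx iota x) (map_mx iota y) (map_mx iota z)
  = base_ext (cycsum f x y z).
Proof. by rewrite /cycsum !br_base !wedge_base !base_extD. Qed.

Lemma delta_base i : 'e_i = map_mx iota 'e_i :> 'rV[A]_n.
Proof. by rewrite map_delta_mx. Qed.

End BaseChange.

Section DualNumbers.
Variable K : fieldType.
Notation D := (dual_numbers K).

Lemma eps_sqr : eps K * eps K = 0.
Proof.
rewrite /eps -in_qpolyM -expr2; apply/val_inj => /=.
by rewrite mk_monic_Xn /= Pdiv.RingMonic.rmodpp // monicXn.
Qed.

Lemma dual_number_eq0 (a b : K) : (a%:A + eps K * b%:A == 0 :> D) = (a == 0) && (b == 0).
Proof.
apply/eqP/andP=> [|[/eqP-> /eqP->]]; last by rewrite !scale0r mulr0 addr0.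
rewrite mulr_algr => /(congr1 val) /=.
(* The polynomial a + bX has degree below 2, so it is its own remainder modulo X^2 and both
   coefficients can be read off. *)
rewrite mk_monic_Xn /= Pdiv.CommonRing.rmodp_small ?size_polyX ?size_polyXn // => e.
by split; [have := congr1 (coefp 0) e|have := congr1 (coefp 1) e];
  rewrite /= !coefE /= ?mulr0 ?mulr1 ?addr0 ?add0r => ->.
Qed.

Definition infinitesimal n (x v : altmap n 'rV[K]_n) : altmap n 'rV[D]_n :=
  [ffun p => base_change D x p + eps K *: base_change D v p].

Lemma infinitesimalE n (x v : altmap n 'rV[K]_n) :
  infinitesimal x v = base_change D x + eps K *: base_change D v.
Proof. by apply/ffunP=> p; rewrite !ffunE. Qed.

Lemma infinitesimal_coord n (x v : altmap n 'rV[K]_n) p k :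
  infinitesimal x v p 0 k = (x p 0 k)%:A + eps K * (v p 0 k)%:A.
Proof. by rewrite !ffunE !mxE. Qed.

Lemma tilde_map_linear (B : comNzRingType) n (V : lmodType B) (w : altmap n B^o) b
    (f h : altmap n V) : tilde (b *: f + h) w = b *: tilde f w + tilde h w.
Proof. exact: tilde_linear_map. Qed.

Lemma cycsum_infinitesimal n (x v : altmap n 'rV[K]_n) i j k :
  cycsum (infinitesimal x v) 'e_i 'e_j 'e_k =
  base_ext D (cycsum x 'e_i 'e_j 'e_k) + eps K *: base_ext D (cycsum v 'e_i 'e_j 'e_k).
Proof.
rewrite infinitesimalE addrC cycsum_linear_map addrC -!cycsum_base.
by rewrite -!delta_base.
Qed.

(** Expanding the Jacobi expression of [x + eps v] gives that of [x], which is zero, plus [eps]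
    times [jac2 x v]; the remaining term carries [eps * eps = 0]. *)
Lemma jacobi_infinitesimal n (x v : altmap n 'rV[K]_n) : jacobi x ->
  jacobi (infinitesimal x v) <-> (forall i j k, jac2 x v 'e_i 'e_j 'e_k = 0).
Proof.
move=> jx.
have key i j k m :
    tilde (infinitesimal x v) (cycsum (infinitesimal x v) 'e_i 'e_j 'e_k) 0 m
    = eps K * (jac2 x v 'e_i 'e_j 'e_k 0 m)%:A.
  rewrite cycsum_infinitesimal linearD linearZ /= infinitesimalE [base_change _ x + _]addrC.
  rewrite !tilde_map_linear !tilde_base.
  have x0 : tilde x (cycsum x 'e_i 'e_j 'e_k) = 0 by rewrite -jacobi_cycsum.
  have sq (v1 v2 v3 : 'rV[K]_n) :
      (eps K *: map_mx (in_alg D) v1 + map_mx (in_alg D) 0 + eps K *: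
        (eps K *: map_mx (in_alg D) v2 + map_mx (in_alg D) v3)) 0 m
      = eps K * ((v3 + v1) 0 m)%:A.
    rewrite map_mx0 addr0 scalerDr scalerA eps_sqr scale0r add0r addrC -scalerDr.
    by rewrite -map_mxD !mxE.
  by rewrite x0 sq.
have key0 (u : 'rV[K]_n) : (forall m, eps K * (u 0 m)%:A = 0) <-> u = 0.
  split=> [h|-> m]; last by rewrite mxE scale0r mulr0.
  apply/rowP=> m; rewrite mxE; apply/eqP.
  have /eqP := h m; rewrite -[X in X == 0]add0r -[X in X + _](scale0r 1).
  by rewrite dual_number_eq0 eqxx.
split=> [h i j k | h].
  by apply: (key0 _).1 => m; rewrite -key -jacobi_cycsum h mxE.
apply: jacobi_on_basis => i j k; apply/rowP=> m.
by rewrite key h !mxE scale0r mulr0.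
Qed.

Section TangentSpaces.
Variables (T : vectType K) (alpha : nat -> dual T) (n : nat).
Implicit Types (x v : altmap n 'rV[K]_n).

(** The linear equations of [LT] pass unchanged to [v], and the Jacobi identity linearizes to the
    cocycle condition. *)
Lemma LT_tangent x v : point (LT alpha (n := n)) x ->
  LT alpha (infinitesimal x v) <-> v \in Z2T alpha x {:'rV[K]_n}.
Proof.
move=> [xinv jx]; split=> [[vinv /(jacobi_infinitesimal v jx) vj]|].
  rewrite !memv_cap; apply/andP; split; last first.
    apply/inv2P=> p k ne; apply/eqP.
    have /eqP := vinv p k ne; rewrite infinitesimal_coord dual_number_eq0.
    by case/andP.
  by apply/andP; split; [apply/lker_d2P|apply/C2P=> p; rewrite memvf].
rewrite !memv_cap => /andP[/andP[/lker_d2P vj _] /inv2P vinv]; split.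
  move=> p k ne; apply/eqP; rewrite infinitesimal_coord dual_number_eq0.
  by rewrite (vinv _ _ ne) (xinv _ _ ne) eqxx.
by apply/(jacobi_infinitesimal v jx).
Qed.

Lemma LTA_tangent A x v : point (LTA alpha A) x ->
  LTA alpha A (infinitesimal x v) <->
  v \in Z2T alpha x {:'rV[K]_n} /\ forall a, a \in A -> v a.1 0 a.2 = 0.
Proof.
move=> [xT xA].
suff e a : a \in A -> (infinitesimal x v a.1 0 a.2 = 1) <-> (v a.1 0 a.2 = 0).
  by split=> [][/(LT_tangent v xT)vT vA]; split=> // a aA; apply/e => //; apply: vA.
move=> aA; rewrite infinitesimal_coord xA // scale1r; split=> [h | ->]; last first.
  by rewrite scale0r mulr0 addr0.
apply/eqP; have /eqP := h; rewrite -subr_eq0 addrC addKr.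
rewrite -[X in X == 0]add0r -[X in X + _](scale0r 1).
by rewrite dual_number_eq0 eqxx.
Qed.

End TangentSpaces.

End DualNumbers.

(** * Positivity of the weights *)

Section PositiveWeights.
Variable K : fieldType.
Hypothesis charK : [pchar K] =i pred0.

(* Positive rationals in K, which carries no order. *)
Definition posrat (x : K) : Prop :=
  exists a, exists b, [/\ (0 < a)%N, (0 < b)%N & x = a%:R / b%:R].

Lemma natK_eq0 a : (a%:R == 0 :> K) = (a == 0)%N.
Proof. by have /pcharf0P := charK; apply. Qed.

Lemma posrat_neq0 x : posrat x -> x != 0.
Proof.
case=> a [b [a0 b0 ->]]; rewrite mulf_neq0 ?invr_eq0 // natK_eq0 -lt0n //.
Qed.

Lemma posratD x y : posrat x -> posrat y -> posrat (x + y).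
Proof.
move=> [a [b [a0 b0 ->]]] [c [d [c0 d0 ->]]].
exists (a * d + c * b)%N, (b * d)%N; rewrite addn_gt0 !muln_gt0 a0 b0 d0.
split=> //; rewrite addf_div ?natK_eq0 -?lt0n // natrD !natrM; congr (_ / _).
Qed.

Lemma posrat_ratr (q : rat) : (0 < q)%R -> posrat (ratr q).
Proof.
move=> q0; exists `|numq q|%N, `|denq q|%N; rewrite !absz_gt0 denq_neq0.
rewrite numq_eq0 gt_eqF //; split=> //.
have e (z : int) : (0 < z)%R -> z%:~R = (`|z|%N)%:R :> K.
  by case: z => // m _.
by rewrite /ratr !e ?denq_gt0 ?numq_gt0.
Qed.

Section Weights.
Variables (T : vectType K) (alpha : nat -> dual T).

(** If [t] is killed by a spanning family of forms, it is killed by every form, in particular by the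
    coordinate forms of a basis of T. *)
Lemma spanning_weights_separate n0 t : <<mkseq alpha n0>>%VS = {:dual T}%VS ->
  (forall i, (i < n0)%N -> alpha i t = 0) -> t = 0.
Proof.
move=> sp h.
have f0 (f : dual T) : f t = 0.
  have : f \in <<mkseq alpha n0>>%VS by rewrite sp memvf.
  rewrite -[mkseq alpha n0]/(val (in_tuple (mkseq alpha n0))) => /coord_span->.
  rewrite sum_lfunE big1 // => -[i /= lti] _; rewrite scale_lfunE nth_mkseq ?h ?scaler0 //.
    by rewrite size_mkseq in lti.
  by rewrite size_mkseq in lti.
rewrite (coord_vbasis (memvf t)) big1 // => i _.
have := f0 (linfun (coord (vbasis {:T}) i : T -> K^o)); rewrite lfunE /= => ->.
by rewrite scale0r.
Qed.

Lemma tor_linear n : linear (tor alpha n).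
Proof.
move=> a s t; apply/matrixP=> i j; rewrite !mxE linearP.
by case: (i == j); rewrite ?mulr1n // !mulr0n mulr0 addr0.
Qed.

Lemma torusP n L : reflect (exists t, L = tor alpha n t) (L \in torus alpha n).
Proof.
apply: (iffP memv_imgP) => [[t _ ->]|[t ->]]; exists t.
- by rewrite (linfunE (@tor_linear n)).
- exact: memvf.
- by rewrite (linfunE (@tor_linear n)).
Qed.

(** Otherwise the elementary diagonal matrix [E] at the last index would be a derivation commuting
    with the torus, and maximality would put it inside the torus. *)
Lemma new_weight_sum m (phi : altmap m.+1 'rV[K]_m.+1) :
  Sigma alpha phi -> (forall t, (forall i, (i < m)%N -> alpha i t = 0) -> t = 0) ->
  (forall i j, (i < m)%N -> (j < m)%N -> alpha m != alpha i - alpha j) ->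
  (forall i, (i < m)%N -> alpha i != 0) ->
  exists p : pairs m, alpha (p1 p) + alpha (p2 p) = alpha m.
Proof.
move=> [[inv jac] [[tD tdiag tcomm] tmax]] sep ndiff nz.
case: (boolP [exists p : pairs m, alpha (p1 p) + alpha (p2 p) == alpha m]) =>
  [/existsP[p /eqP e]|/existsPn none]; first by exists p.
exfalso; pose l : 'rV[K]_m.+1 := 'e_ord_max; pose E := diag_mx l.
have ED : E \in Der phi.
  rewrite memv_ker; apply/eqP/ffunP=> p; apply/rowP=> k; rewrite d1_diag !ffunE [RHS]mxE.
  have [e | /inv->] := eqVneq (alpha (p1 p) + alpha (p2 p)) (alpha k); last by rewrite mulr0.
  have lt12 : (p1 p < p2 p)%N := valP p.
  have lt1 : (p1 p < m)%N by rewrite (leq_trans lt12) // -ltnS.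
  have l0 (i : 'I_m.+1) : (i < m)%N -> l 0 i = 0.
    by move=> lti; rewrite !mxE -[i == _]val_eqE /= ltn_eqF.
  have max (i : 'I_m.+1) : (m <= i)%N -> i = m :> nat.
    by move=> lei; apply/eqP; rewrite eqn_leq lei -ltnS ltn_ord.
  (* Four cases according to whether [p2 p] and [k] equal [m]. In the first the coefficient is zero;
     the others would make the last weight a sum of two earlier ones, a difference of two earlier
     ones, or some earlier weight zero. *)
  have [lt2|/max e2] := ltnP (p2 p) m; have [ltk|/max ek] := ltnP k m.
  - by rewrite !l0 // subr0 addr0 mul0r.
  - have := none (exist _ (Ordinal lt1, Ordinal lt2) lt12).
    by rewrite /p1 /p2 /= e ek eqxx.
  - have := ndiff _ _ ltk lt1; rewrite -e e2 [alpha (p1 p) + _]addrC addrK.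
    by rewrite eqxx.
  rewrite e2 ek in e.
  by have := nz _ lt1; rewrite -[alpha (p1 p)](addrK (alpha m)) e subrr eqxx.
have diagS D : D \in (torus alpha m.+1 + <[E]>)%VS -> exists d, D = diag_mx d.
  case/memv_addP=> _ /torusP[t ->] [_ /vlineP[k ->] ->].
  by exists (\row_i (alpha i t : K) + k *: l); rewrite linearD linearZ.
have tS : is_torus phi (torus alpha m.+1 + <[E]>)%VS.
  split=> [|D /diagS[d ->]|D D' /diagS[d ->] /diagS[d' ->]].
  - by rewrite subv_add tD -memvE.
  - exact: diagonalizable_diag.
  - exact: diag_mxC.
(* By maximality [E] comes from some [t] on which the first [m] weights vanish, so [t = 0], while
   the last weight is 1 there. *)
have /torusP[t Et] : E \in torus alpha m.+1.
  by rewrite -(tmax _ tS (addvSl _ _)) (subvP (addvSr _ _)) ?memv_line.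
have lE (i : 'I_m.+1) : alpha i t = (i == ord_max)%:R.
  by move/matrixP/(_ i i): Et; rewrite /E /l !mxE !eqxx !mulr1n => <-.
have t0 : t = 0.
  apply: sep => j ltj; have := lE (widen_ord (leqnSn m) (Ordinal ltj)).
  by rewrite /= => ->; rewrite -[_ == _]val_eqE /= ltn_eqF.
have := lE ord_max; rewrite t0 linear0 eqxx /= => /esym/eqP.
by rewrite oner_eq0.
Qed.

(** Strong induction on the index, with the [t] given for the initial weights: each later weight is
    a sum of two earlier ones, and positive rationals are closed under addition. *)
Lemma path_weights_positive n0 N : path_of_weights alpha n0 N ->
  exists t, forall i, (i < N)%N -> posrat (alpha i t).
Proof.
move=> [sp [t ht] sig nd]; exists t => i; have [k] := ubnP i.
elim: k i => // k IH i ltik ltiN.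
have [lti|lei] := ltnP i n0.
  by have [q q0 ->] := ht _ lti; apply: posrat_ratr.
have [|phi Sphi] := sig i.+1; first by rewrite ltnW.
have pos j : (j < i)%N -> posrat (alpha j t).
  by move=> ltji; apply: IH; [apply: leq_trans ltji _; rewrite -ltnS|apply: ltn_trans ltiN].
have [s s0|j1 j2|j ltji|p <-] := new_weight_sum Sphi.
- by apply: spanning_weights_separate sp _ => j ltj; apply/s0/(leq_trans ltj).
- by apply: nd; rewrite lei.
- by apply: contraTneq (posrat_neq0 (pos _ ltji)) => ->; rewrite lfunE eqxx.
- by rewrite add_lfunE; apply: posratD; apply: pos.
Qed.

(** With [i = p1 p], a relation [alpha i + alpha n = alpha k] would give [alpha i = 0] if [k = n],
    against positivity in characteristic 0, and would make [alpha n] a difference of earlier weights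
    if [k < n]. This is what makes the new vector central. *)
Lemma simple_path_new_weight n0 n : (n0 <= n)%N -> simple_path alpha n0 n.+1 ->
  forall (p : pairs n.+1) (k : 'I_n.+1), p2 p = ord_max ->
  alpha (p1 p) + alpha (p2 p) != alpha k.
Proof.
move=> le0 [pw _] p k e2; have lt12 : (p1 p < p2 p)%N := valP p.
have lt1 : (p1 p < n)%N by rewrite (leq_trans lt12) // e2.
have [t tpos] := path_weights_positive pw.
have nz : alpha (p1 p) != 0.
  have /posrat_neq0 := tpos _ (ltn_ord (p1 p)).
  by apply: contraNneq => ->; rewrite lfunE.
rewrite e2; have := ltn_ord k; rewrite ltnS leq_eqVlt => /orP[/eqP->|ltk].
  by apply: contraNneq nz => e; rewrite -[alpha _](addrK (alpha n)) e subrr.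
case: pw => _ _ _ nd; have := nd n _ k (p1 p) ltk lt1; rewrite le0 ltnSn => /(_ isT).
by apply: contraNneq => <-; rewrite addrC addKr.
Qed.

End Weights.
End PositiveWeights.

(** * Invariant coboundaries and admissible sets *)

Section DiagonalForms.
Variables (K : fieldType) (T : vectType K) (alpha : nat -> dual T) (m : nat).
Hypothesis alpha_uniq : uniq (mkseq alpha m).
Hypothesis alpha_sep : forall t, (forall i, (i < m)%N -> alpha i t = 0) -> t = 0.

Lemma alpha_inj (i j : 'I_m) : alpha i = alpha j -> i = j.
Proof.
move=> e; apply/val_inj/eqP.
rewrite -(nth_uniq 0 _ _ alpha_uniq) ?size_mkseq ?ltn_ord //.
by rewrite !nth_mkseq ?ltn_ord // e.
Qed.

Lemma mx_coord_linear (q : 'I_m * 'I_m) :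
  linear (fun L : 'M[K]_m => L q.1 q.2 : K^o).
Proof. by move=> a u v; rewrite !mxE. Qed.

Lemma mx_coord_inj (L L' : 'M[K]_m) :
  (forall q : 'I_m * 'I_m, L q.1 q.2 = L' q.1 q.2) -> L = L'.
Proof. by move=> e; apply/matrixP=> i j; apply: (e (i, j)). Qed.

Lemma act1_fun_linear t :
  linear (fun L : 'M[K]_m => L *m tor alpha m t - tor alpha m t *m L).
Proof.
by move=> a x y; rewrite mulmxDl mulmxDr -scalemxAl -scalemxAr scalerBr addrACA opprD.
Qed.

Lemma wt1E t (L : 'M[K]_m) (q : 'I_m * 'I_m) :
  act1 alpha m t L q.1 q.2 = ((alpha q.2 - alpha q.1) t : K) * L q.1 q.2.
Proof.
rewrite /act1 (linfunE (act1_fun_linear t)).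
rewrite mul_mx_diag mul_diag_mx !mxE add_lfunE opp_lfunE.
have id3 (x y z : K) : x * y - z * x = (y - z) * x by ring.
exact: id3.
Qed.

(** An entry of an invariant matrix can be nonzero only between equal weights, and the weights are
    distinct. *)
Lemma C1TP (L : 'M[K]_m) : reflect (exists l, L = diag_mx l) (L \in C1T alpha m).
Proof.
have P := wspace_coord mx_coord_linear mx_coord_inj wt1E 0.
rewrite memv_cap (_ : L \in C1 _) ?andTb; last by apply/C1P=> i; rewrite memvf.
apply: (iffP idP) => [/P h|[l ->]].
  exists (\row_i L i i); apply/matrixP=> i j; rewrite !mxE.
  have [-> | ne] := eqVneq i j; first by rewrite mulr1n.
  rewrite mulr0n; apply: (h (i, j)); rewrite subr_eq0.
  by apply: contraNneq ne => /= /alpha_inj->.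
apply/P => -[i j] /=; rewrite subr_eq0 mxE => ne.
by have [e | _] := eqVneq i j; [rewrite e eqxx in ne | rewrite mulr0n].
Qed.

(** The factor by which [d1 phi (diag_mx l)] rescales the coordinate [a] of the law, see [d1_diag];
    it does not depend on the law. *)
Definition lam (a : multi_index m) (l : 'rV[K]_m) : K :=
  l 0 (p1 a.1) + l 0 (p2 a.1) - l 0 a.2.

Lemma lam_linear a : linear (lam a : _ -> K^o).
Proof.
move=> b u v; rewrite /lam !mxE /GRing.scale /=; ring.
Qed.

(** If [d1 phi L] is invariant, then [L] has weight 0 modulo the T-stable kernel of [d1 phi], so its
    weight 0 projection has the same coboundary; that projection is diagonal. *)
Lemma invariant_coboundary (phi : altmap m 'rV[K]_m) f :
  point (LT alpha (n := m)) phi -> f \in B2 phi {:'rV[K]_m} -> inv2 alpha f ->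
  exists l, f = d1 phi (diag_mx l).
Proof.
move=> phiT /memv_imgP[L _ ->] /inv2P finv.
have act2_lin := weight_action_linear (@alt_coord_linear K m) (@alt_coord_inj K m)
  (@wt2E _ _ alpha m).
have dact t X : d1 phi (act1 alpha m t X) = act2 alpha m t (d1 phi X).
  by rewrite act2_d1 // /act1 (linfunE (act1_fun_linear t)).
have [P [PE _ Pker]] := weight_projection mx_coord_linear wt1E 0.
have st t : (act1 alpha m t @: lker (d1 phi) <= lker (d1 phi))%VS.
  apply/subvP=> _ /memv_imgP[X + ->]; rewrite !memv_ker dact => /eqP->.
  by rewrite linear0.
have := Pker _ L st; rewrite memv_ker linearB subr_eq0 => /(_ _)/eqP <-; last first.
  move=> t; rewrite lfunE scale0r subr0 memv_ker dact.
  by have /(wspaceP _ _ act2_lin) -> := finv; rewrite lfunE scale0r.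
have /C1TP[l ->] : P L \in C1T alpha m; last by exists l.
rewrite memv_cap; apply/andP; split; first by apply/C1P=> i; rewrite memvf.
apply/(wspace_coord mx_coord_linear mx_coord_inj wt1E) => q ne.
by rewrite PE (negPf ne) mul0r.
Qed.

Section Admissible.
Variables (phi : altmap m 'rV[K]_m) (A : {set multi_index m}).
Hypothesis adm : admissible alpha phi A.

Lemma dformE (L : subvs_of (C1T alpha m)) :
  exists l, vsval L = diag_mx l /\
    forall a, dform alpha phi a L = lam a l * phi a.1 0 a.2.
Proof.
have /C1TP[l e] := subvsP L; exists l; split=> // b.
rewrite /dform linfunE ?e ?d1_diag // => c u v.
by rewrite !linearP !ffunE !mxE.
Qed.

(** Dropping [a] would otherwise leave the span, hence the rank, unchanged, against minimality. *)
Lemma admissible_notin_span a : a \in A ->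
  dform alpha phi a \notin <<[seq dform alpha phi b | b in A :\ a]>>%VS.
Proof.
move=> aA; apply/negP=> sp.
have /minsetP[/andP[AJ /eqP rk] amin] := adm.
suff e : <<[seq dform alpha phi b | b in A]>>%VS = <<[seq dform alpha phi b | b in A :\ a]>>%VS.
  have sub : A :\ a \subset A := subsetDl _ _.
  have := amin (A :\ a); rewrite -e rk eqxx (subset_trans sub AJ) => /(_ isT sub)/setP/(_ a).
  by rewrite !inE eqxx aA.
apply/eqP; rewrite eqEsubv; apply/andP; split; apply/span_subvP=> _ /imageP[b bA ->].
  have [-> // | ne] := eqVneq b a.
  by apply/memv_span/imageP; exists b; rewrite // !inE ne.
by apply/memv_span/imageP; exists b => //; move: bA; rewrite inE => /andP[].
Qed.

(** On diagonal cochains [dform] at [a] is [lam a] times the coordinate [a] of [phi], which is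
    nonzero since a zero form lies in every span. Independence thus passes to the forms [lam]
    themselves, and [phi] disappears from the conclusion. *)
Lemma admissible_independent (u : multi_index m -> K) :
  (forall l, \sum_(a in A) u a * lam a l = 0) -> forall a, a \in A -> u a = 0.
Proof.
move=> u0.
have nz a : a \in A -> phi a.1 0 a.2 != 0.
  move=> aA; apply: contraNneq (admissible_notin_span aA) => z.
  suff -> : dform alpha phi a = 0 by rewrite mem0v.
  apply/lfunP=> L; have [l [_ e]] := dformE L.
  by rewrite e z mulr0 lfunE.
move=> a aA; apply: contraNeq (admissible_notin_span aA) => ua.
have -> : dform alpha phi a = \sum_(b in A :\ a)
   (- (phi a.1 0 a.2 / u a) * (u b / phi b.1 0 b.2)) *: dform alpha phi b.
  apply/lfunP=> L; have [l [_ e]] := dformE L.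
  rewrite sum_lfunE e; have := u0 l; rewrite (bigD1 a) //= => /eqP.
  rewrite addr_eq0 => /eqP ul.
  transitivity (\sum_(b in A :\ a) - (phi a.1 0 a.2 / u a) * (u b * lam b l)).
    have -> : lam a l = - (\sum_(b in A :\ a) u b * lam b l) / u a.
      rewrite (eq_bigl (fun b => (b \in A) && (b != a))).
        by rewrite -ul [u a * _]mulrC mulfK.
      by move=> b; rewrite !inE andbC.
    rewrite -mulr_sumr; ring.
  apply: eq_bigr => b; rewrite inE => /andP[_ bA]; rewrite scale_lfunE e.
  have id (x y z w : K) : w != 0 -> - x * (y * z) = (- x * (y / w)) * (z * w).
    by move=> w0; field.
  exact: id (nz b bA).
by apply: rpred_sum => b bA; rewrite rpredZ // memv_span //; apply/imageP; exists b.
Qed.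

Hypothesis cardA : (#|A| + \dim {:T})%N = m.

(** The columns of [Lam] are the forms [lam] indexed by [A]; the rows of [tau] are the diagonals by
    which a basis of T acts. *)
Let Lam : 'M[K]_(m, #|A|) := \matrix_(i, s) lam (enum_val s) 'e_i.
Let tau : 'M[K]_(\dim {:T}, m) := \matrix_(s, i) (alpha i (vbasis {:T})`_s : K).

Let LamE l : l *m Lam = \row_s lam (enum_val s) l.
Proof.
apply/rowP=> s; rewrite !mxE.
pose f : {linear 'rV[K]_m -> K^o} := HB.pack (lam (enum_val s) : _ -> K^o)
  (GRing.isLinear.Build _ _ _ _ (lam (enum_val s) : _ -> K^o) (lam_linear _)).
rewrite -[RHS]/(f l) {2}(row_sum_delta l) linear_sum; apply: eq_bigr => i _.
by rewrite linearZ mxE.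
Qed.

Let Lam_full : row_full Lam.
Proof.
rewrite /row_full -mxrank_tr; change (row_free Lam^T).
apply: inj_row_free => v v0; apply/rowP=> s; rewrite mxE.
pose u (a : multi_index m) := \sum_(s' | enum_val s' == a) v 0 s'.
have us s' : u (enum_val s') = v 0 s'.
  by rewrite /u (big_pred1 s') // => s''; apply: (inj_eq enum_val_inj).
rewrite -us; apply: admissible_independent (enum_valP s) => l.
transitivity ((l *m Lam *m v^T) 0 0); last first.
  by rewrite -mulmxA -[Lam *m _]trmxK trmx_mul trmxK v0 trmx0 mulmx0 mxE.
rewrite LamE mxE big_enum_val; apply: eq_bigr => s' _.
by rewrite us mulrC [(\row__ _) _ _]mxE [v^T _ _]mxE.
Qed.

(** Independent forms take arbitrary prescribed values: [Lam] has full column rank. *)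
Lemma admissible_solvable (b : multi_index m -> K) :
  exists l, forall a, a \in A -> lam a l = b a.
Proof.
have /submxP[l e] : (\row_s b (enum_val (A := mem A) s) <= Lam)%MS by rewrite submx_full.
exists l => a aA; have := congr1 (fun v : 'rV_#|A| => v 0 (enum_rank_in aA a)) e.
by rewrite LamE !mxE enum_rankK_in.
Qed.

(** The torus lies in the common kernel because [A] consists of weight relations, and it fills it
    because both have dimension m - |A| = dim T. *)
Lemma admissible_kernel l : (forall a, a \in A -> lam a l = 0) ->
  exists t, forall i : 'I_m, l 0 i = alpha i t.
Proof.
move=> l0.
have tE (v : 'rV[K]_(\dim {:T})) (i : 'I_m) :
    (v *m tau) 0 i = alpha i (\sum_s v 0 s *: (vbasis {:T})`_s).
  by rewrite mxE linear_sum; apply: eq_bigr => s _; rewrite mxE linearZ.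
have tau_free : row_free tau.
  apply: inj_row_free => v v0.
  have /freeP/(_ (v 0)) h := basis_free (vbasisP {:T}).
  apply/rowP=> s; rewrite mxE; apply: h; apply: alpha_sep => i lti.
  by rewrite -[i]/(val (Ordinal lti)) -tE v0 mxE.
have /minsetP[/andP[/subsetP AJ _] _] := adm.
have tauLam : (tau <= kermx Lam)%MS.
  apply/sub_kermxP/row_matrixP=> s; rewrite row_mul LamE row0; apply/rowP=> q.
  have := AJ _ (enum_valP q); rewrite inE => /eqP e.
  rewrite !mxE /lam !mxE -e add_lfunE.
  exact: subrr.
have : (kermx Lam <= tau)%MS.
  rewrite -(geq_leqif (mxrank_leqif_sup tauLam)) mxrank_ker (eqP Lam_full) (eqP tau_free).
  by rewrite leq_subLR cardA.
have ll : (l <= kermx Lam)%MS.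
  apply/sub_kermxP; rewrite LamE; apply/rowP=> q; rewrite !mxE l0 //.
  exact: enum_valP.
move/(submx_trans ll)/submxP=> [v ->].
by exists (\sum_s v 0 s *: (vbasis {:T})`_s) => i; rewrite tE.
Qed.

End Admissible.
End DiagonalForms.

(** * Weight spaces of cohomology and homology *)

Section Coboundaries.
Variables (K : fieldType) (n : nat) (phi : altmap n 'rV[K]_n).
Implicit Types (L : 'M[K]_n) (M : {vspace 'rV[K]_n}).

Lemma br_deltaii (i : 'I_n) (f : altmap n 'rV[K]_n) : br f 'e_i 'e_i = 0.
Proof.
rewrite /br (_ : wedge _ _ = 0) ?linear0 //.
by apply/ffunP=> p; rewrite !ffunE mulrC subrr.
Qed.

Lemma br_d1 L x (k : 'I_n) : br (d1 phi L) x 'e_k =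
  br phi x ('e_k *m L) + br phi (x *m L) 'e_k - br phi x 'e_k *m L.
Proof.
have onp p : br (d1 phi L) 'e_(p1 p) 'e_(p2 p) =
    br phi 'e_(p1 p) ('e_(p2 p) *m L) + br phi ('e_(p1 p) *m L) 'e_(p2 p)
    - br phi 'e_(p1 p) 'e_(p2 p) *m L.
  by rewrite !br_delta /d1 (linfunE (d1_linear phi)) ffunE [br phi ('e__ *m L) _]brC.
have z (f : altmap n 'rV[K]_n) y : br f 0 y = 0.
  by rewrite -[X in br f X](scale0r (0 : 'rV[K]_n)) brZl scale0r.
rewrite (row_sum_delta x); elim/big_ind: _ => [|u v eu ev|i _].
- by rewrite mul0mx !z mul0mx subr0 addr0.
- rewrite mulmxDl !brDl eu ev mulmxDl; apply/rowP=> m; rewrite !mxE; ring.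
rewrite -scalemxAl !brZl -scalemxAl -scalerDr -scalerBr; congr (_ *: _).
case: (ltngtP i k) => [ltik|ltki|/val_inj->].
- exact: (onp (exist _ (i, k) ltik)).
- have /= := onp (exist _ (k, i) ltki); rewrite /p1 /p2 /= => e.
  rewrite brC e [br phi 'e_i 'e_k]brC [br phi 'e_i (_ *m L)]brC [br phi (_ *m L) 'e_k]brC.
  by rewrite mulNmx; apply/rowP=> m; rewrite !mxE; ring.
by rewrite !br_deltaii mul0mx subr0 [br phi 'e_k _]brC addNr.
Qed.

Lemma d1_cocycle L : jacobi phi -> d1 phi L \in lker (d2 phi).
Proof.
move=> jac; apply/lker_d2P=> i j k.
(* The expression is the sum of the three Jacobi identities with one argument moved by [L], minus
   the image under [L] of the Jacobi identity itself. *)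
have comb (a b c d e f g h m r s t u v w : 'rV[K]_n) :
    a + b + c = 0 -> d + e + f = 0 -> g + h + m = 0 -> r + s + t = 0 ->
    g + r - u + (e + h - v) + (t + f - w)
      + (d + u - a + (s + v - b) + (m + w - c)) = 0.
  move=> e1 e2 e3 e4.
  transitivity ((d + e + f) + (g + h + m) + (r + s + t) - (a + b + c)).
    by apply/rowP=> l; rewrite !mxE; ring.
  by rewrite e1 e2 e3 e4 !addr0 subrr.
have := jac ('e_i *m L) 'e_j 'e_k; have := jac 'e_i ('e_j *m L) 'e_k.
have := jac 'e_i 'e_j ('e_k *m L).
have := congr1 (mulmx^~ L) (jac 'e_i 'e_j 'e_k); rewrite mul0mx !mulmxDl.
rewrite /jac2 /cycsum !linearD /= -!/(br _ _ _) !br_d1 !brBl !brDl.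
exact: comb.
Qed.

Lemma B2_sub_Z2 M : jacobi phi ->
  (forall L, L \in C1 M -> d1 phi L \in C2 M) -> (B2 phi M <= Z2 phi M)%VS.
Proof.
move=> jac st; apply/subvP=> _ /memv_imgP[L ML ->].
by rewrite memv_cap d1_cocycle ?st.
Qed.

End Coboundaries.

Section WeightSpaces.
Variables (K : fieldType) (T : vectType K) (alpha : nat -> dual T) (n : nat).
Variable phi : altmap n 'rV[K]_n.
Hypothesis phiT : point (LT alpha (n := n)) phi.
Implicit Types (M : {vspace 'rV[K]_n}) (w : altmap n K^o).

Definition wtw (p : pairs n) : dual T := alpha (p1 p) + alpha (p2 p).

Lemma altK_coord_linear (p : pairs n) : linear (fun w : altmap n K^o => w p : K^o).
Proof. by move=> a u v; rewrite !ffunE. Qed.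

Lemma wtwE t w p : actw alpha n t w p = (wtw p t : K) * w p.
Proof.
rewrite /actw /tildeL lfunE /=; set h := finfun _.
have hE q : h q p = (wtw p t : K) * (p == q)%:R.
  rewrite [h q]ffunE wedge_tor ffunE -(wedge_delta K q p) /wtw add_lfunE; exact: erefl.
rewrite /tilde sum_ffunE (bigD1 p) //= big1 => [|q qp].
  by rewrite addr0 ffunE hE eqxx mulr1; apply: mulrC.
by rewrite ffunE hE eq_sym (negPf qp) mulr0; apply: mulr0.
Qed.

Lemma wspacewP a w : (w \in wspace (actw alpha n) a) <->
  (forall p, wtw p != a -> w p = 0).
Proof.
apply: (wspace_coord altK_coord_linear _ wtwE) => u v e; exact/ffunP.
Qed.

Lemma tilde_actw t w : tilde phi (actw alpha n t w) = tilde phi w *m tor alpha n t.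
Proof.
rewrite /tilde mulmx_suml; apply: eq_bigr => p _; rewrite wtwE -scalemxAl.
have [inv _] := phiT; apply/rowP=> k; rewrite mul_mx_diag !mxE.
have [e | /inv->] := eqVneq (alpha (p1 p) + alpha (p2 p)) (alpha k); last first.
  by rewrite mul0r !mulr0.
have id3 (u v c : K) : c * u * v = u * (v * c) by ring.
by rewrite /wtw e id3.
Qed.

Lemma lker_tildeL (V : vectType K) (h : altmap n V) w :
  (w \in lker (tildeL h)) = (tilde h w == 0).
Proof. by rewrite memv_ker lfunE. Qed.

Lemma Omega_sub_ker : (Omega phi <= lker (tildeL phi))%VS.
Proof.
apply/span_subvP=> _ /imageP[s _ ->]; rewrite memv_ker lfunE /=.
by have [_ jac] := phiT; rewrite -jacobi_cycsum jac.
Qed.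

(** Invariant classes have invariant representatives, by [weight_space_quot]. *)
Lemma H2T_image M : (forall t m, m \in M -> m *m tor alpha n t \in M) ->
  (B2 phi M <= Z2 phi M)%VS ->
  H2T alpha phi M = (class2 phi M @: Z2T alpha phi M)%VS.
Proof.
move=> st sBZ.
have sZ t : (act2 alpha n t @: Z2 phi M <= Z2 phi M)%VS.
  by apply: act2_Z2 => // m; apply: st.
have sB t : (act2 alpha n t @: B2 phi M <= B2 phi M)%VS.
  apply/subvP=> _ /memv_imgP[_ /memv_imgP[L ML ->] ->].
  by rewrite act2_d1 // memv_img // act1_C1 // => m; apply: st.
exact: (weight_space_quot (@alt_coord_linear K n) (@alt_coord_inj K n) (@wt2E _ _ alpha n) 0 sBZ sZ sB).
Qed.

Lemma HH2w_image a :
  HH2w alpha phi a = (hclass phi @: (lker (tildeL phi) :&: wspace (actw alpha n) a))%VS.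
Proof.
apply: (weight_space_quot altK_coord_linear _ wtwE) => [u v e|||t].
- exact/ffunP.
- exact: Omega_sub_ker.
- move=> t; apply/subvP=> _ /memv_imgP[w + ->]; rewrite !lker_tildeL.
  by rewrite tilde_actw => /eqP->; rewrite mul0mx.
exact: Omega_stable.
Qed.

Lemma actw_projection a : exists P : 'End(altmap n K^o),
  (forall w p, P w p = (wtw p == a)%:R * w p) /\ (P @: Omega phi <= Omega phi)%VS.
Proof.
have [P [PE PS _]] := weight_projection altK_coord_linear wtwE a.
by exists P; split=> //; apply: PS => t; apply: Omega_stable.
Qed.

End WeightSpaces.

(** * Restriction to the first n basis vectors *)

Section LastVector.
Variable n : nat.

Lemma pair_cases (q : pairs n.+1) : (exists p, q = wpair p) \/ p2 q = ord_max.
Proof.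
have lt12 : (p1 q < p2 q)%N := valP q.
have [lt2|ge2] := ltnP (p2 q) n; last first.
  by right; apply/val_inj/eqP; rewrite /= eqn_leq ge2 -ltnS ltn_ord.
have lt1 := ltn_trans lt12 lt2.
left; exists (exist _ (Ordinal lt1, Ordinal lt2) lt12); apply: val_inj => /=.
rewrite [LHS]surjective_pairing; congr (_, _); exact: val_inj.
Qed.

Lemma ord_cases (k : 'I_n.+1) : (exists i : 'I_n, k = wid i) \/ k = ord_max.
Proof.
have [ltk|gek] := ltnP k n.
  by left; exists (Ordinal ltk); apply: val_inj.
by right; apply/val_inj/eqP; rewrite /= eqn_leq gek -ltnS ltn_ord.
Qed.

Lemma wid_neq_max (i : 'I_n) : (wid i == ord_max) = false.
Proof. by rewrite -val_eqE /= ltn_eqF. Qed.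

Lemma p1_wpair (p : pairs n) : p1 (wpair p) = wid (p1 p).
Proof. by []. Qed.

Lemma p2_wpair (p : pairs n) : p2 (wpair p) = wid (p2 p).
Proof. by []. Qed.

Lemma wid_inj : injective (@wid n).
Proof. by move=> i j /(congr1 val) /= e; apply: val_inj. Qed.

Lemma wpair_inj : injective (@wpair n).
Proof.
move=> p q /(congr1 val)/= [e1 e2]; apply: val_inj.
by rewrite [LHS]surjective_pairing [RHS]surjective_pairing; congr (_, _); apply: val_inj.
Qed.

Lemma sum_wpair (V : nmodType) (F : pairs n.+1 -> V) :
  (forall q, p2 q = ord_max -> F q = 0) -> \sum_q F q = \sum_p F (wpair p).
Proof.
move=> F0; rewrite (bigID (mem (@wpair n @: [set: pairs n]))) /= [X in _ + X]big1 => [|q nq].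
  rewrite addr0 big_imset /=; last by move=> p q _ _; apply: wpair_inj.
  by apply: eq_bigl => p; rewrite inE.
by have [[p e]|/F0//] := pair_cases q; rewrite e imset_f ?inE in nq.
Qed.

Section Truncation.
Variable K : fieldType.
Implicit Types (X Y Z : 'rV[K]_n.+1) (w : altmap n.+1 K^o).

Definition trunc X : 'rV[K]_n := \row_k X 0 (wid k).

Definition wres w : altmap n K^o := [ffun p => w (wpair p)].

Lemma trunc_wid i : trunc 'e_(wid i) = 'e_i.
Proof. by apply/rowP=> k; rewrite !mxE (inj_eq wid_inj). Qed.

Lemma trunc_max : trunc 'e_ord_max = 0.
Proof. by apply/rowP=> k; rewrite !mxE wid_neq_max andbF. Qed.

Lemma wres_wedge X Y : wres (wedge X Y) = wedge (trunc X) (trunc Y).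
Proof. by apply/ffunP=> p; rewrite !ffunE !mxE. Qed.

Lemma wresD w w' : wres (w + w') = wres w + wres w'.
Proof. by apply/ffunP=> p; rewrite !ffunE. Qed.

(** In a pair i < j the new index can only come second, so this says that [x] vanishes as soon as
    one argument is ['e_ord_max]. *)
Definition max_central (x : altmap n.+1 'rV[K]_n.+1) : Prop :=
  forall q, p2 q = ord_max -> x q = 0.

Lemma tilde_restr (f : altmap n.+1 'rV[K]_n.+1) w :
  max_central f -> tilde f w = tilde (restr f) (wres w).
Proof.
move=> f0; rewrite /tilde sum_wpair => [|q /f0->]; last exact: scaler0.
by apply: eq_bigr => p _; rewrite !ffunE.
Qed.

Lemma trunc_tilde (x : altmap n.+1 'rV[K]_n.+1) w :
  max_central x -> trunc (tilde x w) = tilde (forget x) (wres w).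
Proof.
move=> x0; rewrite tilde_restr //; apply/rowP=> k; rewrite mxE !summxE.
by apply: eq_bigr => p _; rewrite !ffunE !mxE.
Qed.

(** Since the new vector is central, cyclic sums for the extension restrict to cyclic sums for the
    quotient law; this is how Omega of the smaller law enters the cocycle condition. *)
Lemma wres_cycsum (x : altmap n.+1 'rV[K]_n.+1) X Y Z : max_central x ->
  wres (cycsum x X Y Z) = cycsum (forget x) (trunc X) (trunc Y) (trunc Z).
Proof.
by move=> x0; rewrite /cycsum !wresD !wres_wedge !trunc_tilde // !wres_wedge.
Qed.

Lemma br_max (x : altmap n.+1 'rV[K]_n.+1) Z : max_central x ->
  br x 'e_ord_max Z = 0.
Proof.
move=> x0; rewrite /br tilde_restr // wres_wedge trunc_max.
suff -> : wedge 0 (trunc Z) = 0 :> altmap n K^o by rewrite linear0.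
by apply/ffunP=> p; rewrite !ffunE !mxE !mul0r subrr.
Qed.

Lemma KeE X : X \in Ke K n -> X = X 0 ord_max *: 'e_ord_max.
Proof.
by case/vlineP=> c ->; rewrite !mxE !eqxx mulr1.
Qed.

Lemma KeP X : (X \in Ke K n) <-> (forall k : 'I_n, X 0 (wid k) = 0).
Proof.
split=> [/KeE-> k | h]; first by rewrite !mxE wid_neq_max andbF mulr0.
apply/vlineP; exists (X 0 ord_max); apply/rowP=> k; rewrite !mxE eqxx.
have [[i ->]|->] := ord_cases k; first by rewrite h wid_neq_max mulr0.
by rewrite eqxx mulr1.
Qed.

End Truncation.
End LastVector.

(** * The fibre over a law *)

Section Fibre.
Variables (K : fieldType) (T : vectType K) (alpha : nat -> dual T) (n : nat).
Hypothesis new_weight : forall (p : pairs n.+1) (k : 'I_n.+1), p2 p = ord_max ->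
  alpha (p1 p) + alpha (p2 p) != alpha k.
Hypothesis alpha_uniq : uniq (mkseq alpha n.+1).
Variable phi : altmap n 'rV[K]_n.
Hypothesis phiT : point (LT alpha (n := n)) phi.
Notation g1 := 'rV[K]_n.+1.
Implicit Types (x f v : altmap n.+1 g1) (w : altmap n K^o).

Lemma inv2_max_central f : inv2 alpha f -> max_central f.
Proof.
by move=> finv q q2; apply/rowP=> k; rewrite mxE finv // new_weight.
Qed.

Lemma fibreP x : point (fibre alpha phi) x <-> point (LT alpha (n := n.+1)) x /\ forget x = phi.
Proof.
have e : base_change (K^o) phi = phi.
  by apply/ffunP=> p; rewrite ffunE; apply/rowP=> k; rewrite mxE; apply: mulr1.
by split=> [[xT fx]|[xT fx]]; split=> //; rewrite ?e // fx e.
Qed.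

Lemma Ke_tor t m : m \in Ke K n -> m *m tor alpha n.+1 t \in Ke K n.
Proof.
by move/KeP=> h; apply/KeP=> k; rewrite mul_mx_diag mxE h mul0r.
Qed.

(** The cochain [f] seen as a linear form on the exterior square of K^n, through its component along
    ['e_ord_max]. *)
Definition ev f w : K := tilde (restr f) w 0 ord_max.

Lemma ev_linear f : linear (ev f : _ -> K^o).
Proof. by move=> a u v; rewrite /ev tilde_linear !mxE. Qed.

Lemma ev_linear_map w : linear (ev^~ w : _ -> K^o).
Proof.
move=> a u v; rewrite /ev (_ : restr _ = a *: restr u + restr v).
  by rewrite tilde_map_linear !mxE.
by apply/ffunP=> p; rewrite !ffunE.
Qed.

Lemma ev_Ke f w : f \in C2 (Ke K n) -> tilde (restr f) w = ev f w *: 'e_ord_max.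
Proof.
move/C2P=> fK; apply: KeE; rewrite /tilde rpred_sum // => p _.
by rewrite rpredZ // ffunE fK.
Qed.

(** Values of [f] are central, so the terms of [jac2] applying the law to them drop out, and [ev f]
    on the cyclic sums of [phi] remains. The criterion involves [phi] alone, so all points of the
    fibre share the same cocycles. *)
Lemma Z2T_fibreP x f : point (fibre alpha phi) x ->
  f \in Z2T alpha x (Ke K n) <->
  [/\ inv2 alpha f, f \in C2 (Ke K n) & forall w, w \in Omega phi -> ev f w = 0].
Proof.
move=> /fibreP[[xinv xjac] fx]; have xmax := inv2_max_central xinv.
suff e : inv2 alpha f -> f \in C2 (Ke K n) ->
    (f \in lker (d2 x)) <-> (forall w, w \in Omega phi -> ev f w = 0).
  rewrite !memv_cap; split=> [/andP[/andP[fZ fK] /inv2P finv]|[finv fK fO]].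
    by split=> //; apply/e.
  by rewrite fK (e finv fK).2 //; apply/inv2P.
move=> finv fK; have fmax := inv2_max_central finv.
have jE X Y Z : jac2 x f X Y Z =
    ev f (cycsum phi (trunc X) (trunc Y) (trunc Z)) *: 'e_ord_max.
  have x0 U V W : br x (br f U V) W = 0.
    have -> : br f U V = ev f (wres (wedge U V)) *: 'e_ord_max.
      by rewrite /br tilde_restr // ev_Ke.
    by rewrite brZl br_max // scaler0.
  have -> : jac2 x f X Y Z = tilde f (cycsum x X Y Z).
    by rewrite /jac2 [X in X + _ = _](_ : _ = 0) ?add0r // /cycsum !linearD /=
      -!/(br _ _ _) !x0 !addr0.
  by rewrite tilde_restr // wres_cycsum // fx ev_Ke.
have e0 c : (c *: 'e_ord_max == 0 :> g1) = (c == 0).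
  apply/eqP/eqP=> [/rowP/(_ ord_max)|->]; last by rewrite scale0r.
  by rewrite !mxE !eqxx mulr1.
split=> [/lker_d2P h w | h].
  have ls : linear (ev f : _ -> K^o) := ev_linear f.
  have wl u : (u \in lker (linfun (ev f : _ -> K^o))) = (ev f u == 0).
    by rewrite memv_ker (linfunE ls).
  move=> wO; apply/eqP; rewrite -wl; move: wO; apply/subvP.
  apply/span_subvP=> _ /imageP[s _ ->]; rewrite wl -e0.
  have := h (wid s.1.1) (wid s.1.2) (wid s.2).
  by rewrite jE !trunc_wid => ->.
apply/lker_d2P=> i j k; apply/eqP; rewrite jE e0 h //; exact: cycsum_Omega.
Qed.

(** Fixing [forget x] lets [v] move only the coordinates with upper index [ord_max], and invariance
    kills the pairs containing the new vector; so [v] takes its values in [Ke]. *)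
Lemma fibre_tangent x v : point (fibre alpha phi) x ->
  v \in Z2T alpha x (Ke K n) <-> fibre alpha phi (infinitesimal x v).
Proof.
move=> xP; have /fibreP[xT fx] := xP; split=> [|[/(LT_tangent v xT)]].
  move=> vZ; have /(Z2T_fibreP v xP)[vinv /C2P vK _] := vZ; split.
    apply/(LT_tangent v xT); move: vZ; rewrite !memv_cap => /andP[/andP[-> _] ->].
    by rewrite andbT; apply/C2P=> q; rewrite memvf.
  apply/ffunP=> p; apply/rowP=> k; rewrite !ffunE !mxE -fx !ffunE !mxE.
  by have /KeP -> := vK (wpair p); rewrite /GRing.in_alg scale0r mulr0 addr0.
rewrite !memv_cap => /andP[/andP[vZ _] vinv] /ffunP fv; rewrite vZ vinv andbT /=.
apply/C2P=> q; have [[p ->]|q2] := pair_cases q; last first.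
  by rewrite inv2_max_central ?mem0v //; apply/inv2P.
apply/KeP=> k; apply/eqP; have /rowP/(_ k) := fv p.
rewrite !ffunE !mxE -fx !ffunE !mxE /GRing.in_alg => /eqP.
rewrite -[X in _ == X -> _]addr0 (inj_eq (addrI _)) -[X in X == _]add0r -[X in X + _](scale0r 1).
by rewrite dual_number_eq0 eqxx.
Qed.

(** The basis vector of the exterior square attached to the pair [p]. *)
Definition dl (p : pairs n) : altmap n K^o := [ffun q => (q == p)%:R].

Lemma tilde_dl (V : lmodType K) (h : altmap n V) p : tilde h (dl p) = h p.
Proof.
rewrite /tilde (bigD1 p) //= big1 => [|q qp].
  by rewrite ffunE eqxx scale1r addr0.
by rewrite ffunE (negPf qp) scale0r.
Qed.

Lemma dl_sum w : w = \sum_p (w p : K) *: dl p.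
Proof.
apply/ffunP=> q; rewrite sum_ffunE (bigD1 q) //= big1 => [|p pq].
  rewrite addr0 !ffunE eqxx; exact: esym (mulr1 _).
rewrite !ffunE eq_sym (negPf pq); exact: mulr0.
Qed.

Lemma wspace_dl p : wtw alpha p = alpha n -> dl p \in wspace (actw alpha n) (alpha n).
Proof.
move=> e; apply/wspacewP=> q; rewrite ffunE; apply: contraNeq.
by have [-> _|_] := eqVneq q p; rewrite ?e // eqxx.
Qed.

(* The weight of the new vector is not a weight of K^n. *)
Lemma wspace_new_sub_ker :
  (wspace (actw alpha n) (alpha n) <= lker (tildeL phi))%VS.
Proof.
apply/subvP=> w /wspacewP wa; rewrite lker_tildeL /tilde big1 // => p _.
have [e|/wa->] := eqVneq (wtw alpha p) (alpha n); last exact: scale0r.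
suff -> : phi p = 0 by rewrite scaler0.
apply/rowP=> k; rewrite mxE; have [inv _] := phiT; apply: inv.
rewrite -/(wtw alpha p) e; apply/eqP=> h.
have := alpha_inj alpha_uniq (i := ord_max) (j := wid k) h.
by move/eqP; rewrite eq_sym wid_neq_max.
Qed.

Lemma Z2T_ev_eq0 x f : point (fibre alpha phi) x -> f \in Z2T alpha x (Ke K n) ->
  (forall w, w \in wspace (actw alpha n) (alpha n) -> ev f w = 0) -> f = 0.
Proof.
move=> xP /(Z2T_fibreP f xP)[finv /C2P fK _] f0; apply/ffunP=> q.
have [[p ->]|q2] := pair_cases q; last by rewrite inv2_max_central // ffunE.
rewrite [RHS]ffunE (KeE (fK _)) (_ : f _ _ _ = 0) ?scale0r //.
have [e|ne] := eqVneq (wtw alpha p) (alpha n); last exact: finv.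
by rewrite -(f0 _ (wspace_dl e)) /ev tilde_dl ffunE.
Qed.

(** The inverse construction to [ev]: a linear form on the exterior square made into a cochain with
    values in [Ke]. *)
Definition cocycle_of (m : 'Hom(altmap n K^o, K^o)) : altmap n.+1 g1 :=
  ext0 [ffun p => (m (dl p) : K) *: 'e_ord_max].

Lemma ext0_wpair (h : altmap n g1) p : ext0 h (wpair p) = h p.
Proof.
rewrite ffunE; case: pickP => [q /eqP/wpair_inj-> //|/(_ p)].
by rewrite eqxx.
Qed.

Lemma ext0_max (h : altmap n g1) : max_central (ext0 h).
Proof.
move=> q q2; rewrite ffunE; case: pickP => // p /eqP e.
by have := wid_neq_max (p2 p); rewrite -p2_wpair e q2 eqxx.
Qed.

Lemma restr_ext0 (h : altmap n g1) : restr (ext0 h) = h.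
Proof. by apply/ffunP=> p; rewrite ffunE ext0_wpair. Qed.

Lemma ev_cocycle_of (m : 'Hom(altmap n K^o, K^o)) w : ev (cocycle_of m) w = m w.
Proof.
rewrite /ev restr_ext0 /tilde [in RHS](dl_sum w) linear_sum summxE.
apply: eq_bigr => p _; rewrite linearZ !ffunE !mxE !eqxx mulr1; exact: erefl.
Qed.

Lemma cocycle_of_Z2T x (m : 'Hom(altmap n K^o, K^o)) : point (fibre alpha phi) x ->
  (forall p, wtw alpha p != alpha n -> m (dl p) = 0) ->
  (forall w, w \in Omega phi -> m w = 0) ->
  cocycle_of m \in Z2T alpha x (Ke K n).
Proof.
move=> xP m0 mO; apply/(Z2T_fibreP _ xP); split=> [q k ne||w wO].
- have [[p e]|q2] := pair_cases q; last by rewrite ext0_max // mxE.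
  rewrite e ext0_wpair ffunE !mxE.
  have [ek|_] := eqVneq k ord_max; last by rewrite andbF mulr0.
  by rewrite m0 ?mul0r //; rewrite e ek in ne.
- apply/C2P=> q; have [[p ->]|q2] := pair_cases q; last by rewrite ext0_max // mem0v.
  by rewrite ext0_wpair ffunE rpredZ // memv_line.
by rewrite ev_cocycle_of mO.
Qed.

End Fibre.

(** * Representatives of classes in a quotient *)

Section QuotientVsval.
Variables (K : fieldType) (vT : vectType K) (U V : {vspace vT}).

Lemma qpi_vsval (h : quotv U V) : qpi U V (vsval h) = h.
Proof.
rewrite comp_lfunE lfunE /= -[RHS]vsvalK; congr (vsproj _ _).
by rewrite daddv_pi_id ?capv_diff ?subvsP.
Qed.

Lemma quotv_vsval_mem (h : quotv U V) : vsval h \in U.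
Proof. by rewrite (subvP (diffvSl U V)) ?subvsP. Qed.

Lemma qpi_lift u : (V <= U)%VS -> u \in U -> u - vsval (qpi U V u) \in V.
Proof.
move=> sVU uU; rewrite -(qpi_eq0 sVU) ?rpredB ?quotv_vsval_mem //.
by rewrite linearB /= qpi_vsval subrr.
Qed.

End QuotientVsval.

Lemma alt_coordBZ (K : fieldType) n (f h : altmap n 'rV[K]_n) c p k :
  (f - c *: h) p 0 k = f p 0 k - c * h p 0 k.
Proof. by rewrite !ffunE !mxE. Qed.

(** * Tangent spaces of the slices and invariant cohomology *)

Section TangentFibre.
Variables (K : fieldType) (T : vectType K) (alpha : nat -> dual T) (n : nat).
Hypothesis new_weight : forall (p : pairs n.+1) (k : 'I_n.+1), p2 p = ord_max ->
  alpha (p1 p) + alpha (p2 p) != alpha k.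
Hypothesis alpha_uniq : uniq (mkseq alpha n.+1).
Variables (phi : altmap n 'rV[K]_n) (phi1 : altmap n.+1 'rV[K]_n.+1).
Variables (A : {set multi_index n}) (A1 : {set multi_index n.+1}) (p0 : pairs n).
Hypothesis phiT : point (LT alpha (n := n)) phi.
Hypothesis phi1F : point (fibre alpha phi) phi1.
Hypothesis phi1A : forall a, a \in A1 -> phi1 a.1 0 a.2 = 1.
Hypothesis A1E : A1 = (wpair p0, ord_max) |: @wmulti n @: A.
(** Admissibility enters through the forms [lam] alone, so what it gives at the laws of the
    filiation can be used at [phi] and [phi1]. *)
Hypothesis kerA : forall l : 'rV[K]_n, (forall a, a \in A -> lam a l = 0) ->
  exists t, forall i : 'I_n, l 0 i = alpha i t.
Hypothesis kerA1 : forall l : 'rV[K]_n.+1, (forall a, a \in A1 -> lam a l = 0) ->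
  exists t, forall i : 'I_n.+1, l 0 i = alpha i t.
Hypothesis solA1 : forall b : multi_index n.+1 -> K,
  exists l, forall a, a \in A1 -> lam a l = b a.

Notation g1 := 'rV[K]_n.+1.
Notation a := (alpha n).
Notation M := (Ke K n).
Notation full := (fullv : {vspace g1}).
Notation psi' := (ext0 (psi phi1)).
Notation Z2M := (Z2T alpha phi1 M).
Notation wa := (wspace (actw alpha n) a).

Let phi1T : point (LT alpha (n := n.+1)) phi1.
Proof. by case/fibreP: phi1F. Qed.

Let phi1f : forget phi1 = phi.
Proof. by case/fibreP: phi1F. Qed.

Let phi1inv : inv2 alpha phi1 := phi1T.1.

Let phi1max : max_central phi1 := inv2_max_central new_weight phi1inv.

Let psiE q : psi' q = phi1 q 0 ord_max *: 'e_ord_max.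
Proof.
have [[p ->]|q2] := pair_cases q; first by rewrite ext0_wpair !ffunE.
by rewrite ext0_max // phi1max // mxE scale0r.
Qed.

Let psi_d1 : psi' = - d1 phi1 (diag_mx 'e_ord_max).
Proof.
apply/ffunP=> q; apply/rowP=> k; rewrite psiE ffunE 2!mxE [RHS]mxE d1_diag.
have [[p ->]|q2] := pair_cases q; last by rewrite phi1max // !mxE mul0r mulr0 oppr0.
rewrite !mxE p1_wpair p2_wpair !eqxx !wid_neq_max /= addr0 sub0r mulNr opprK.
by have [->|_] := eqVneq k ord_max; rewrite ?mulr1 ?mul1r // mulr0 mul0r.
Qed.

Let C1M_C2M L : L \in C1 M -> d1 phi1 L \in C2 M.
Proof.
move=> /C1P LM; apply/C2P=> q; rewrite /d1 (linfunE (d1_linear phi1)) ffunE.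
have brM X i : br phi1 X ('e_i *m L) = 0.
  by rewrite -rowE (KeE (LM i)) linearZ /= brC br_max // oppr0 scaler0.
rewrite !brM subrr sub0r rpredN mulmx_sum_row rpred_sum // => i _.
by rewrite rpredZ.
Qed.

Let B2M_Z2M : (B2 phi1 M <= Z2 phi1 M)%VS.
Proof. by apply: B2_sub_Z2; [case: phi1T|exact: C1M_C2M]. Qed.

Let B2f_Z2f : (B2 phi1 full <= Z2 phi1 full)%VS.
Proof.
apply: B2_sub_Z2; first by case: phi1T.
by move=> L _; apply/C2P=> q; rewrite memvf.
Qed.

Let psi_B2 : psi' \in B2 phi1 M.
Proof.
rewrite psi_d1 rpredN memv_img //; apply/C1P=> i; rewrite rowE delta_diag.
have [e|ne] := eqVneq i ord_max; first by rewrite e rpredZ // memv_line.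
by rewrite mxE (negPf ne) scale0r mem0v.
Qed.

Lemma psi_Z2T : psi' \in Z2M.
Proof.
rewrite memv_cap (subvP B2M_Z2M) ?psi_B2 //; apply/inv2P=> q k ne.
rewrite psiE !mxE eqxx /=; have [e|_] := eqVneq k ord_max; last by rewrite mulr0.
by rewrite phi1inv ?mul0r //; rewrite e in ne.
Qed.

Let Z2M_sub_full : (Z2M <= Z2T alpha phi1 full)%VS.
Proof.
apply/subvP=> f; rewrite !memv_cap => /andP[/andP[-> _] ->].
by rewrite andbT; apply/C2P=> q; rewrite memvf.
Qed.

Let B2M_sub_full : (B2 phi1 M <= B2 phi1 full)%VS.
Proof.
by apply: limgS; apply/subvP=> L _; apply/C1P=> i; rewrite memvf.
Qed.

(** Write [f] as the coboundary of [diag_mx l]. Having values in [Ke], it vanishes on the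
    coordinates coming from [A], where [phi1] is 1, so [kerA] makes the truncation of [l] toral and
    only the last entry of [l] matters. Coboundaries of all cochains are allowed, which also serves
    for [i2bar]. *)
Lemma coboundary_line f : f \in Z2M -> f \in B2 phi1 full -> f \in <[psi']>%VS.
Proof.
move=> fZ fB; have /(Z2T_fibreP new_weight f phi1F)[finv /C2P fM _] := fZ.
have [l fl] := invariant_coboundary alpha_uniq phi1T fB finv.
have [|t lt] := kerA (l := trunc l).
  move=> b bA; have b1 : wmulti b \in A1.
    by rewrite A1E inE imset_f ?orbT.
  have : f (wpair b.1) 0 (wid b.2) = 0 by have /KeP := fM (wpair b.1).
  rewrite fl d1_diag (phi1A b1) mulr1 p1_wpair p2_wpair => h.
  by rewrite /lam !mxE.
(* On a nonzero coordinate with upper index [ord_max] the two lower entries of [l] add up to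
   [a t]. *)
apply/vlineP; exists ((a t : K) - l 0 ord_max).
apply/ffunP=> q; apply/rowP=> k; rewrite ffunE [RHS]mxE psiE 2!mxE fl d1_diag.
have [[p ->]|q2] := pair_cases q; last by rewrite phi1max // !mxE mulr0 mul0r mulr0.
rewrite p1_wpair p2_wpair.
have lw i : l 0 (wid i) = alpha i t by rewrite -lt mxE.
have [e|/phi1inv z] := eqVneq (alpha (p1 (wpair p)) + alpha (p2 (wpair p))) (alpha k); last first.
  rewrite z mulr0; have [ek|_] := eqVneq k ord_max; last by rewrite andbF !mulr0.
  by rewrite -ek z mul0r mulr0.
have {}e : alpha (p1 p) t + alpha (p2 p) t = alpha k t by rewrite -e add_lfunE.
rewrite !lw e; have [[i ->]|->] := ord_cases k.
  by rewrite lw subrr mul0r wid_neq_max andbF !mulr0.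
by rewrite !eqxx mulr1.
Qed.

Let psi_p0 : ev psi' (dl K p0) = 1.
Proof.
rewrite /ev tilde_dl ffunE psiE !mxE !eqxx mulr1.
by apply: (phi1A (a := (wpair p0, ord_max))); rewrite A1E !inE eqxx.
Qed.

Let psi_neq0 : psi' (wpair p0) 0 ord_max = 1.
Proof. by have := psi_p0; rewrite /ev tilde_dl ffunE. Qed.

Definition vanishing (B : {set multi_index n.+1}) : {vspace altmap n.+1 g1} :=
  (\bigcap_(b in B) lker (linfun (fun f : altmap n.+1 g1 => f b.1 0%R b.2 : K^o)))%VS.

Lemma vanishingP B f : (f \in vanishing B) <-> (forall b, b \in B -> f b.1 0 b.2 = 0).
Proof.
rewrite memvE; split=> [/subv_bigcapP h b bB|h].
  by have := h b bB; rewrite -memvE memv_ker (linfunE (@alt_coord_linear _ _ b)) => /eqP.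
apply/subv_bigcapP=> b bB.
by rewrite -memvE memv_ker (linfunE (@alt_coord_linear _ _ b)) h.
Qed.

Let H2TM : H2T alpha phi1 M = (class2 phi1 M @: Z2M)%VS.
Proof. by apply: H2T_image => // t m; apply: Ke_tor. Qed.

Let H2Tf : H2T alpha phi1 full = (class2 phi1 full @: Z2T alpha phi1 full)%VS.
Proof. by apply: H2T_image => // t m _; rewrite memvf. Qed.

Let class_eq0 f : f \in Z2M -> (class2 phi1 M f == 0) = (f \in <[psi']>%VS).
Proof.
move=> fZ; have fZ2 : f \in Z2 phi1 M by move: fZ; rewrite memv_cap => /andP[].
rewrite /class2 qpi_eq0 //; apply/idP/idP => [fB|/vlineP[c ->]].
  by apply: coboundary_line => //; apply: (subvP B2M_sub_full).
by rewrite rpredZ.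
Qed.

(** Classes are taken modulo the line of [psi'], whose coordinate at [(wpair p0, ord_max)] is 1;
    requiring that coordinate to vanish selects one representative per class. The other coordinates
    in [A1] vanish on all cochains with values in [Ke]. *)
Lemma tangent_slice : exists U : {vspace altmap n.+1 g1},
  [/\ is_tangent_space (schemeI (fibre alpha phi) (LTA alpha A1)) phi1 U,
      (U <= Z2M)%VS & iso_on (class2 phi1 M) U (H2T alpha phi1 M)].
Proof.
exists (Z2M :&: vanishing A1)%VS; split.
- move=> v; rewrite -/(infinitesimal phi1 v) memv_cap; split.
    move=> /andP[vZ /vanishingP vA]; split; first exact/(fibre_tangent new_weight v phi1F).
    by apply/LTA_tangent => //; split=> //; apply: (subvP Z2M_sub_full).
  move=> [/(fibre_tangent new_weight v phi1F)-> /LTA_tangent[|_ vA]] //.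
  by apply/vanishingP.
- exact: capvSl.
split.
  apply/eqP; rewrite -subv0; apply/subvP=> f; rewrite memv_cap memv_ker memv_cap.
  case/andP=> fc /andP[fZ /vanishingP fA]; move: fc; rewrite class_eq0 //.
  case/vlineP=> c fE; have := fA (wpair p0, ord_max).
  rewrite A1E !inE eqxx => /(_ isT); rewrite fE ffunE mxE psi_neq0 mulr1 => ->.
  by rewrite scale0r mem0v.
rewrite H2TM; apply/eqP; rewrite eqEsubv limgS ?capvSl //=.
apply/subvP=> _ /memv_imgP[f fZ ->].
have psiZ := psi_Z2T; set c := f (wpair p0) 0 ord_max.
have fcZ : f - c *: psi' \in Z2M by rewrite rpredB ?rpredZ.
have -> : class2 phi1 M f = class2 phi1 M (f - c *: psi').
  apply/eqP; rewrite -subr_eq0 -linearB /= opprB addrC subrK class_eq0 ?rpredZ //.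
  by rewrite memv_line.
apply: memv_img; rewrite memv_cap fcZ; apply/vanishingP=> b; rewrite A1E !inE.
case/orP=> [/eqP-> /=|/imsetP[b' _ ->]].
  by rewrite alt_coordBZ psi_neq0 mulr1 subrr.
have /(Z2T_fibreP new_weight _ phi1F)[_ /C2P h _] := fcZ.
by have /KeP := h (wpair b'.1); apply.
Qed.

(** The slice complements the invariant coboundaries: [solA1] gives a coboundary agreeing with any
    cocycle on [A1], and by [kerA1] a coboundary zero on [A1] comes from the torus, hence is
    zero. *)
Lemma tangent_LTA : exists U : {vspace altmap n.+1 g1},
  [/\ is_tangent_space (LTA alpha A1) phi1 U, (U <= Z2T alpha phi1 full)%VS
    & iso_on (class2 phi1 full) U (H2T alpha phi1 full)].
Proof.
exists (Z2T alpha phi1 full :&: vanishing A1)%VS; split; last 2 first.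
- exact: capvSl.
- split; last first.
    rewrite H2Tf; apply/eqP; rewrite eqEsubv limgS ?capvSl //=.
    apply/subvP=> _ /memv_imgP[f fZ ->].
    have [l ll] := solA1 (fun b => f b.1 0 b.2).
    set h := d1 phi1 (diag_mx l).
    have hE q k : h q 0 k = (l 0 (p1 q) + l 0 (p2 q) - l 0 k) * phi1 q 0 k.
      exact: d1_diag.
    have hB : h \in B2 phi1 full.
      by apply: memv_img; apply/C1P=> i; rewrite memvf.
    have hZ : h \in Z2T alpha phi1 full.
      rewrite memv_cap (subvP B2f_Z2f) //; apply/inv2P=> q k ne.
      by rewrite hE phi1inv // mulr0.
    have -> : class2 phi1 full f = class2 phi1 full (f - h).
      apply/eqP; rewrite -subr_eq0 -linearB /= opprB addrC subrK /class2 qpi_eq0 //.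
      by rewrite (subvP B2f_Z2f).
    apply: memv_img; rewrite memv_cap rpredB //; apply/vanishingP=> b bA.
    by rewrite -[h]scale1r alt_coordBZ hE (phi1A bA) !(mul1r, mulr1) -ll // subrr.
  apply/eqP; rewrite -subv0; apply/subvP=> f; rewrite memv_cap memv_ker memv_cap.
  case/andP=> fc /andP[+ /vanishingP fA]; rewrite memv_cap => /andP[fZ2 finv].
  move: fc finv; rewrite /class2 qpi_eq0 // => fB /inv2P finv.
  have [l fl] := invariant_coboundary alpha_uniq phi1T fB finv.
  have [b bA|t lt] := kerA1 (l := l).
    by rewrite -(fA b bA) fl d1_diag (phi1A bA) mulr1.
  suff -> : f = 0 by rewrite mem0v.
  apply/ffunP=> q; apply/rowP=> k; rewrite fl d1_diag !lt ffunE [RHS]mxE.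
  have [e|/phi1inv->] := eqVneq (alpha (p1 q) + alpha (p2 q)) (alpha k); last by rewrite mulr0.
  by rewrite -e add_lfunE subrr mul0r.
move=> v; rewrite -/(infinitesimal phi1 v) memv_cap.
have LTA1 : point (LTA alpha A1) phi1 by split.
split=> [/andP[vZ /vanishingP vA]|/(LTA_tangent _ LTA1)[-> vA]].
  exact/(LTA_tangent _ LTA1).
by apply/vanishingP.
Qed.

Lemma quot_psi_iso :
  iso_on (quot_map \1%VF Z2M <[psi']>%VS (Z2 phi1 M) (B2 phi1 M)) fullv (H2T alpha phi1 M).
Proof.
have sV : (<[psi']> <= Z2M)%VS.
  by apply/subvP=> _ /vlineP[c ->]; rewrite rpredZ // psi_Z2T.
have qE u : u \in Z2M ->
    quot_map \1%VF Z2M <[psi']>%VS (Z2 phi1 M) (B2 phi1 M) (qpi Z2M <[psi']> u) = class2 phi1 M u.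
  move=> uZ; rewrite quot_mapE ?id_lfunE ?lim1g ?capvSl //.
split.
  apply/eqP; rewrite capvf -subv0; apply/subvP=> h; rewrite memv_ker.
  have [u uZ <-] := qpi_onto h; rewrite qE // class_eq0 // => up.
  have /eqP -> : qpi Z2M <[psi']> u == 0 by rewrite qpi_eq0.
  exact: mem0v.
rewrite H2TM; apply/vspaceP=> c; apply/memv_imgP/memv_imgP=> [[h _ ->]|[u uZ ->]].
  by have [u uZ <-] := qpi_onto h; exists u => //; rewrite qE.
by exists (qpi Z2M <[psi']> u); rewrite ?memvf // qE.
Qed.

Lemma i2bar_H2T :
  (lker (i2bar phi1 M) :&: H2T alpha phi1 M)%VS = 0%VS
  /\ (i2bar phi1 M @: H2T alpha phi1 M <= H2T alpha phi1 full)%VS.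
Proof.
have sZ : (Z2 phi1 M <= Z2 phi1 full)%VS.
  apply/subvP=> f; rewrite !memv_cap => /andP[-> _].
  by apply/C2P=> q; rewrite memvf.
have iE f : f \in Z2M -> i2bar phi1 M (class2 phi1 M f) = class2 phi1 full f.
  rewrite memv_cap => /andP[fZ _].
  by rewrite /i2bar quot_mapE ?id_lfunE ?lim1g.
split.
  apply/eqP; rewrite -subv0; apply/subvP=> c; rewrite memv_cap memv_ker H2TM.
  case/andP=> + /memv_imgP[f fZ cE]; rewrite cE iE // => fB.
  have /eqP-> : class2 phi1 M f == 0; last exact: mem0v.
  rewrite class_eq0 // coboundary_line //.
  rewrite /class2 qpi_eq0 // in fB.
  by move: fZ; rewrite memv_cap => /andP[fZ _]; apply: (subvP sZ).
apply/subvP=> _ /memv_imgP[c + ->]; rewrite H2TM => /memv_imgP[f fZ ->].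
by rewrite iE // H2Tf memv_img // (subvP Z2M_sub_full).
Qed.

(** * Duality between invariant cocycles and homology *)

Let ker_wa : (wa <= lker (tildeL phi))%VS.
Proof. exact: wspace_new_sub_ker. Qed.

Let ev_Omega (f : altmap n.+1 g1) w : f \in Z2M -> w \in Omega phi -> ev f w = 0.
Proof. by case/(Z2T_fibreP new_weight f phi1F) => _ _; apply. Qed.

Let evB (f : altmap n.+1 g1) u v : ev f (u - v) = ev f u - ev f v.
Proof. by rewrite [u - v]addrC -[- v]scaleN1r (ev_linear f) scaleN1r addrC. Qed.

Let HH2wE : HH2w alpha phi a = (hclass phi @: wa)%VS.
Proof. by rewrite HH2w_image // (capv_idPr ker_wa). Qed.

(* Extends [m] from the weight space to the exterior square along the projection. *)
Lemma cocycle_extending (m : 'Hom(altmap n K^o, K^o)) :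
  (forall w, w \in Omega phi -> w \in wa -> m w = 0) ->
  exists2 f, f \in Z2M & forall w, w \in wa -> ev f w = m w.
Proof.
move=> mO; have [P [PE PO]] := actw_projection phiT a.
have mE w : (m \o P)%VF w = m (P w) by rewrite comp_lfunE.
have Pwa w : P w \in wa.
  by apply/wspacewP=> p ne; rewrite PE (negPf ne) mul0r.
exists (cocycle_of (m \o P)).
  apply: (cocycle_of_Z2T new_weight phi1F) => [p ne|w wO]; rewrite mE.
    suff -> : P (dl K p) = 0 by rewrite linear0.
    apply/ffunP=> q; rewrite PE !ffunE; have [->|_] := eqVneq q p; last exact: mulr0.
    by rewrite (negPf ne) mul0r.
  by rewrite mO // (subvP PO) // memv_img.
move=> w wwa; rewrite ev_cocycle_of mE (_ : P w = w) //.
apply/ffunP=> p; rewrite PE; have [_|ne] := eqVneq (wtw alpha p) a; first by rewrite mul1r.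
by have /wspacewP/(_ p ne)-> := wwa; rewrite mulr0.
Qed.

(** A cocycle kills Omega, so [ev f] descends to homology. It is determined by its values on [wa],
    and conversely a form on the weight space of homology pulls back to one that extends to a
    cocycle. *)
Lemma Z2T_homology_dual :
  exists F : 'Hom(altmap n.+1 g1, dual (subvs_of (HH2w alpha phi a))),
    iso_on F Z2M fullv /\
    forall f w (c : subvs_of (HH2w alpha phi a)), f \in Z2M ->
      w \in lker (tildeL phi) -> vsval c = hclass phi w -> F f c = tilde (restr f) w 0 ord_max.
Proof.
(* Evaluation at a chosen representative makes the map defined and linear on all cochains;
   independence of the choice holds on cocycles. *)
pose Ff (f : altmap n.+1 g1) (c : subvs_of (HH2w alpha phi a)) : K^o :=
  ev f (vsval (vsval c)).
have Ff_lin f : linear (Ff f).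
  by move=> k u v; rewrite /Ff !linearP; apply: (ev_linear f).
have F_lin : linear (fun f => linfun (Ff f) : dual (subvs_of (HH2w alpha phi a))).
  move=> k f h; apply/lfunP=> c; rewrite add_lfunE scale_lfunE !(linfunE (Ff_lin _)).
  exact: (ev_linear_map _ k f h).
pose F : 'Hom(altmap n.+1 g1, dual (subvs_of (HH2w alpha phi a))) :=
  linfun (fun f => linfun (Ff f) : dual (subvs_of (HH2w alpha phi a))).
have FE f w c : f \in Z2M -> w \in lker (tildeL phi) -> vsval c = hclass phi w ->
    F f c = ev f w.
  move=> fZ wk cw; rewrite /F (linfunE F_lin) (linfunE (Ff_lin f)) /Ff.
  apply/esym/eqP; rewrite -subr_eq0 -evB; apply/eqP/ev_Omega => //.
  by rewrite cw qpi_lift // (Omega_sub_ker phiT).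
exists F; split; last exact: FE.
split.
  apply/eqP; rewrite -subv0; apply/subvP=> f; rewrite memv_cap memv_ker => /andP[/eqP Ff0 fZ].
  rewrite (Z2T_ev_eq0 new_weight phi1F fZ) ?mem0v // => w wwa.
  have cH : hclass phi w \in HH2w alpha phi a by rewrite HH2wE memv_img.
  rewrite -(FE _ _ (vsproj (HH2w alpha phi a) (hclass phi w)) fZ) ?vsprojK //.
    by rewrite Ff0 lfunE.
  exact: (subvP ker_wa).
apply/vspaceP=> g; rewrite memvf.
(* Off the weight space [vsproj] is an arbitrary projection; only the values of [m] on [wa] are
   used. *)
pose m : 'Hom(altmap n K^o, K^o) :=
  (g \o linfun (vsproj (HH2w alpha phi a)) \o hclass phi)%VF.
have mE w : m w = g (vsproj (HH2w alpha phi a) (hclass phi w)).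
  by rewrite 2!comp_lfunE [linfun _ _]lfunE.
have [w wO _|f fZ fm] := cocycle_extending (m := m).
  have /eqP w0 : hclass phi w == 0.
    by rewrite qpi_eq0 ?(Omega_sub_ker phiT) // (subvP (Omega_sub_ker phiT)).
  by rewrite mE w0 !linear0.
apply/memv_imgP; exists f => //; apply/lfunP=> c.
have := subvsP c; rewrite {2}HH2wE => /memv_imgP[w wwa cw].
by rewrite (FE _ w) // ?(subvP ker_wa) // fm // mE -cw vsvalK.
Qed.

(** * The hyperplane cut out by the extension cocycle *)

Notation N := (hyp_num alpha phi phi1 a).
Notation D := (hyp_den alpha phi a).

Let evZ (f : altmap n.+1 g1) c u : ev f (c *: u) = c * ev f u.
Proof.
have e0 : ev f 0 = 0 by rewrite -(subrr 0) evB subrr.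
by have := ev_linear f c u 0; rewrite !addr0 e0 addr0.
Qed.

Let memN w : (w \in N) = (w \in wa) && (ev psi' w == 0).
Proof.
have psiM : psi' \in C2 M.
  by move: psi_Z2T; rewrite !memv_cap => /andP[/andP[_ ->]].
rewrite /hyp_num !memv_cap (lker_tildeL (psi phi1)).
have -> : tilde (psi phi1) w = ev psi' w *: 'e_ord_max by rewrite -ev_Ke // restr_ext0.
have e0 c : (c *: 'e_ord_max == 0 :> g1) = (c == 0).
  have ne : ('e_ord_max == 0 :> g1) = false.
    by apply/eqP=> /rowP/(_ ord_max)/eqP; rewrite !mxE !eqxx oner_eq0.
  by rewrite scaler_eq0 ne orbF.
rewrite e0; have [wwa|_] := boolP (w \in wa); first by rewrite (subvP ker_wa).
by rewrite andbF.
Qed.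

Let D_sub_N : (D <= N)%VS.
Proof.
apply/subvP=> w; rewrite memN memv_cap => /andP[wO ->] /=.
by rewrite ev_Omega // psi_Z2T.
Qed.

Let N_sub_wa : (N <= wa)%VS.
Proof. by apply/subvP=> w; rewrite memN => /andP[]. Qed.

Let wt_p0 : wtw alpha p0 = a.
Proof.
apply/eqP; apply: contraT => ne; have := psi_neq0.
by rewrite psiE phi1inv // scale0r mxE => /esym/eqP; rewrite oner_eq0.
Qed.

(** As [psi'] takes the value 1 on [dl K p0], this vector spans a complement of [N] in [wa]. *)
Let N_split w : w \in wa -> w - ev psi' w *: dl K p0 \in N.
Proof.
move=> wwa; rewrite memN rpredB ?rpredZ ?wspace_dl //=.
by rewrite evB evZ psi_p0 mulr1 subrr.
Qed.

Lemma homology_hyperplane :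
  let j := quot_map \1%VF N D (lker (tildeL phi)) (Omega phi) in
  [/\ (D <= N)%VS, lker j = 0%VS, (limg j <= HH2w alpha phi a)%VS
    & \dim (HH2w alpha phi a) = (\dim (limg j)).+1].
Proof.
move=> j.
have sOk := Omega_sub_ker phiT.
have sNk : (N <= lker (tildeL phi))%VS := subv_trans N_sub_wa ker_wa.
have jE u : u \in N -> j (qpi N D u) = hclass phi u.
  by move=> uN; rewrite /j quot_mapE ?id_lfunE ?lim1g ?capvSl.
have limgE : limg j = (hclass phi @: N)%VS.
  apply/vspaceP=> c; apply/memv_imgP/memv_imgP=> [[h _ ->]|[u uN ->]].
    by have [u uN <-] := qpi_onto h; exists u => //; rewrite jE.
  by exists (qpi N D u); rewrite ?memvf // jE.
split=> //.
- apply/eqP; rewrite -subv0; apply/subvP=> h; rewrite memv_ker.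
  have [u uN <-] := qpi_onto h; rewrite jE // qpi_eq0 // ?(subvP sNk) // => uO.
  suff /eqP-> : qpi N D u == 0 by rewrite mem0v.
  by rewrite qpi_eq0 // memv_cap uO (subvP N_sub_wa).
- by rewrite limgE HH2wE limgS.
have dlk : dl K p0 \in lker (tildeL phi) by rewrite (subvP ker_wa) ?wspace_dl.
(* The form [ev psi'] kills Omega and [N] but not [dl K p0], so the class of the latter lies outside
   the image; with [N_split] this gives codimension exactly one. *)
have notin : hclass phi (dl K p0) \notin limg j.
  rewrite limgE; apply/memv_imgP=> -[u uN /eqP].
  have duk : dl K p0 - u \in lker (tildeL phi) by rewrite rpredB // (subvP sNk).
  rewrite -subr_eq0 -linearB /= qpi_eq0 // => uO.
  have := ev_Omega psi_Z2T uO; rewrite evB psi_p0.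
  move: uN; rewrite memN => /andP[_ /eqP->] /eqP.
  by rewrite subr0 oner_eq0.
have -> : HH2w alpha phi a = (limg j + <[hclass phi (dl K p0)]>)%VS.
  rewrite HH2wE limgE; apply/eqP; rewrite eqEsubv subv_add limgS //=.
  apply/andP; split; last by rewrite -memvE memv_img ?wspace_dl.
  apply/subvP=> _ /memv_imgP[w wwa ->].
  rewrite -(subrK (ev psi' w *: dl K p0) w) linearD.
  apply: memv_add; first by rewrite memv_img ?N_split.
  by rewrite linearZ rpredZ ?memv_line.
rewrite dimv_disjoint_sum ?dim_vline; last first.
  apply/eqP; rewrite -subv0; apply/subvP=> c; rewrite memv_cap => /andP[+ /vlineP[k ck]].
  rewrite {}ck; have [->|k0] := eqVneq k 0; first by move=> _; rewrite scale0r mem0v.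
  by rewrite rpredZeq (negPf k0) (negPf notin).
suff -> : hclass phi (dl K p0) != 0 by rewrite addn1.
by apply: contraNneq notin => ->; rewrite mem0v.
Qed.

(** For [L] with central values, [d1 phi1 L] is minus [phi1] followed by [L], and [phi1] vanishes on
    [N]: its K^n part since [wa] lies in the kernel of [tilde phi], its last coordinate by
    definition of [N]. *)
Let B2M_ev_N f w : f \in B2 phi1 M -> w \in N -> ev f w = 0.
Proof.
move=> /memv_imgP[L LM ->]; rewrite memN => /andP[wwa /eqP psiw].
have LE q : d1 phi1 L q = - (phi1 q *m L).
  have brM X i : br phi1 X ('e_i *m L) = 0.
    move/C1P: LM => /(_ i) h.
    by rewrite -rowE (KeE h) linearZ /= brC br_max // oppr0 scaler0.
  by rewrite /d1 (linfunE (d1_linear phi1)) ffunE !brM subrr sub0r.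
have -> : ev (d1 phi1 L) w = - (tilde (restr phi1) w *m L) 0 ord_max.
  rewrite /ev /tilde mulmx_suml !summxE -sumrN; apply: eq_bigr => p _.
  by rewrite ffunE LE [restr phi1 p]ffunE scalerN -scalemxAl mxE.
suff -> : tilde (restr phi1) w = 0 by rewrite mul0mx mxE oppr0.
apply/rowP=> k; rewrite [RHS]mxE; have [[i ->]|->] := ord_cases k; last first.
  rewrite -psiw /ev /tilde !summxE; apply: eq_bigr => p _.
  by rewrite mxE [in RHS]mxE ![restr _ p]ffunE psiE !mxE !eqxx mulr1.
have : tilde phi w = 0.
  by apply/eqP; rewrite -lker_tildeL (subvP ker_wa).
move/rowP/(_ i); rewrite mxE => <-; rewrite -phi1f /tilde !summxE.
by apply: eq_bigr => p _; rewrite !mxE !ffunE mxE.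
Qed.

(** Evaluation pairs cocycles with [N]. Coboundaries kill [N] and cocycles kill [D], so it descends
    to classes on both sides. *)
Lemma H2T_hyperplane_dual :
  exists G : 'Hom(H2 phi1 M, dual (quotv N D)),
    iso_on G (H2T alpha phi1 M) fullv /\
    forall f w, f \in Z2M -> w \in N ->
      G (class2 phi1 M f) (qpi N D w) = tilde (restr f) w 0 ord_max.
Proof.
pose Gf (c : H2 phi1 M) (u : quotv N D) : K^o := ev (vsval c) (vsval u).
have Gf_lin c : linear (Gf c).
  by move=> k u v; rewrite /Gf linearP; apply: (ev_linear (vsval c)).
have G_lin : linear (fun c => linfun (Gf c) : dual (quotv N D)).
  move=> k c d; apply/lfunP=> u; rewrite add_lfunE scale_lfunE !(linfunE (Gf_lin _)).
  by rewrite /Gf linearP; apply: (ev_linear_map _ k (vsval c) (vsval d)).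
pose G : 'Hom(H2 phi1 M, dual (quotv N D)) :=
  linfun (fun c => linfun (Gf c) : dual (quotv N D)).
have GE f w : f \in Z2M -> w \in N -> G (class2 phi1 M f) (qpi N D w) = ev f w.
  move=> fZ wN; rewrite /G (linfunE G_lin) (linfunE (Gf_lin _)) /Gf.
  set w' := vsval (qpi N D w); set f' := vsval (class2 phi1 M f).
  have w'N : w' \in N := quotv_vsval_mem _.
  have fZ2 : f \in Z2 phi1 M by move: fZ; rewrite memv_cap => /andP[].
  have e1 : ev (f - f') w' = 0.
    by apply: B2M_ev_N => //; apply: qpi_lift.
  have e2 : ev f (w - w') = 0.
    by apply: ev_Omega => //; have := qpi_lift D_sub_N wN; rewrite memv_cap => /andP[].
  have /eqP : ev f w' - ev f' w' = 0.
    by rewrite -e1 [f - f']addrC -[- f']scaleN1r (ev_linear_map w') scaleN1r addrC.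
  rewrite subr_eq0 => /eqP <-.
  by move/eqP: e2; rewrite evB subr_eq0 => /eqP.
exists G; split; last exact: GE.
split.
  apply/eqP; rewrite -subv0; apply/subvP=> c; rewrite memv_cap memv_ker H2TM.
  case/andP=> + /memv_imgP[f fZ cE]; rewrite {c}cE => /eqP G0.
  have fN w : w \in N -> ev f w = 0 by move=> wN; rewrite -GE // G0 lfunE.
  have fpsi : f - ev f (dl K p0) *: psi' \in Z2M by rewrite rpredB ?rpredZ ?psi_Z2T.
  (* A cocycle zero on [N] is known from its value at [dl K p0], hence is a multiple of [psi'],
     whose class is zero. *)
  have f0 : f - ev f (dl K p0) *: psi' = 0.
    apply: (Z2T_ev_eq0 new_weight phi1F fpsi) => w wwa.
    rewrite [f - _]addrC -scaleNr (ev_linear_map w); have := fN _ (N_split wwa).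
    rewrite evB evZ => /eqP; rewrite subr_eq0 => /eqP->.
    have id2 (u v : K) : - u * v + v * u = 0 by ring.
    exact: id2.
  have /eqP-> : class2 phi1 M f == 0; last exact: mem0v.
  rewrite class_eq0 //; apply/vlineP; exists (ev f (dl K p0)).
  by apply/eqP; rewrite -subr_eq0 f0.
apply/vspaceP=> g; rewrite memvf.
(* [projv N] extends the form from [N] to the whole exterior square; on Omega it is zero in weight
   [a], where Omega meets [wa] in [D]. *)
pose m : 'Hom(altmap n K^o, K^o) := (g \o qpi N D \o projv N)%VF.
have mE w : w \in N -> m w = g (qpi N D w).
  by move=> wN; rewrite 2!comp_lfunE projv_id.
have [w wO wwa|f fZ fm] := cocycle_extending (m := m).
  have wD : w \in D by rewrite memv_cap wO.
  have wN := subvP D_sub_N _ wD.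
  have /eqP w0 : qpi N D w == 0 by rewrite qpi_eq0.
  by rewrite mE // w0 linear0.
apply/memv_imgP; exists (class2 phi1 M f); first by rewrite H2TM memv_img.
apply/lfunP=> h; have [u uN <-] := qpi_onto h.
by rewrite GE // fm ?mE // (subvP N_sub_wa).
Qed.

End TangentFibre.

(** * From the path of weights and the filiation to the three assertions *)

Theorem theorem5p2 (K : closedFieldType) (charK : [pchar K] =i pred0)
  (T : vectType K) (alpha : nat -> dual T) (n0 n : nat) (le_n0_n : (n0 <= n)%N)
  (alpha_path : simple_path alpha n0 n.+1)
  (A : {set multi_index n}) (A1 : {set multi_index n.+1})
  (filiation : direct_filiation alpha A A1)
  (phi : altmap n 'rV[K]_n) (phi1 : altmap n.+1 'rV[K]_n.+1)
  (phiP : point (LTA alpha A) phi)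
  (phi1P : point (schemeI (fibre alpha phi) (LTA alpha A1)) phi1) :
  let a := alpha n in
  let M := Ke K n in
  let full := fullv : {vspace 'rV[K]_n.+1} in
  let psi' := ext0 (psi phi1) in
  (* 1 *)
  [/\ [/\ (forall x, point (fibre alpha phi) x ->
             is_tangent_space (fibre alpha phi) x (Z2T alpha phi1 M)
             /\ Z2T alpha x M = Z2T alpha phi1 M)
        & exists F : 'Hom(altmap n.+1 'rV[K]_n.+1,
                          dual (subvs_of (HH2w alpha phi a))),
            iso_on F (Z2T alpha phi1 M) fullv
            /\ forall f w (c : subvs_of (HH2w alpha phi a)),
                 f \in Z2T alpha phi1 M -> w \in lker (tildeL phi) ->
                 vsval c = hclass phi w -> F f c = tilde (restr f) w 0 ord_max],
  (* 2 *)
      [/\ (exists U : {vspace altmap n.+1 'rV[K]_n.+1},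
             [/\ is_tangent_space
                   (schemeI (fibre alpha phi) (LTA alpha A1)) phi1 U,
                 (U <= Z2T alpha phi1 M)%VS
               & iso_on (class2 phi1 M) U (H2T alpha phi1 M)]),
          psi' \in Z2T alpha phi1 M
          /\ iso_on (quot_map \1%VF (Z2T alpha phi1 M) <[psi']>%VS
                              (Z2 phi1 M) (B2 phi1 M))
                    fullv (H2T alpha phi1 M),
          (exists U : {vspace altmap n.+1 'rV[K]_n.+1},
             [/\ is_tangent_space (LTA alpha A1) phi1 U,
                 (U <= Z2T alpha phi1 full)%VS
               & iso_on (class2 phi1 full) U (H2T alpha phi1 full)])
        & (lker (i2bar phi1 M) :&: H2T alpha phi1 M)%VS = 0%VS
          /\ (i2bar phi1 M @: H2T alpha phi1 M <= H2T alpha phi1 full)%VS]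
  (* 3 *)
    & let N := hyp_num alpha phi phi1 a in
      let D := hyp_den alpha phi a in
      let j := quot_map \1%VF N D (lker (tildeL phi)) (Omega phi) in
      [/\ (D <= N)%VS,
          lker j = 0%VS,
          (limg j <= HH2w alpha phi a)%VS,
          \dim (HH2w alpha phi a) = (\dim (limg j)).+1
        & exists G : 'Hom(H2 phi1 M, dual (quotv N D)),
            iso_on G (H2T alpha phi1 M) fullv
            /\ forall f w, f \in Z2T alpha phi1 M -> w \in N ->
                 G (class2 phi1 M f) (qpi N D w)
                 = tilde (restr f) w 0 ord_max]].
Proof.
move=> a M full psi'.
have new := simple_path_new_weight charK le_n0_n alpha_path.
have [[span _ _ _] uniq1] := alpha_path.
have uniq0 : uniq (mkseq alpha n).
  by move: uniq1; rewrite mkseqS rcons_uniq => /andP[].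
have sep m : (n0 <= m)%N -> forall t, (forall i, (i < m)%N -> alpha i t = 0) -> t = 0.
  move=> le0 t t0; apply: spanning_weights_separate span _ => i lti.
  exact/t0/(leq_trans lti).
have [cardA cardA1 [p A1p] [phi' [phi1' [_ _ _ adm adm1]]]] := filiation.
(* The added multi-index is a weight relation, and none has the new vector among its lower
   indices. *)
have [p0 pE] : exists p0, p = wpair p0.
  have [//|p2m] := pair_cases p.
  have /minsetP[/andP[/subsetP AJ _] _] := adm1.
  have := AJ (p, ord_max); rewrite A1p setU11 => /(_ isT).
  by rewrite inE (negPf (new _ _ p2m)).
rewrite {p}pE in A1p.
have phiT := phiP.1; have phi1F := phi1P.1; have phi1A := phi1P.2.2.
have kerA := admissible_kernel uniq0 (sep n le_n0_n) adm cardA.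
have kerA1 := admissible_kernel uniq1 (sep n.+1 (leqW le_n0_n)) adm1 cardA1.
have solA1 := admissible_solvable uniq1 adm1.
split; [split|split|].
(* The description of the cocycles by [Z2T_fibreP] does not depend on the point of the fibre. *)
- move=> x xF; have Zx : Z2T alpha x M = Z2T alpha phi1 M.
    apply/vspaceP=> f; apply/idP/idP.
      by move/(Z2T_fibreP new f xF)/(Z2T_fibreP new f phi1F).
    by move/(Z2T_fibreP new f phi1F)/(Z2T_fibreP new f xF).
  split; last exact: Zx.
  rewrite -Zx => v; exact: (fibre_tangent new v xF).
- exact: (Z2T_homology_dual new uniq1 phiT phi1F).
- exact: (tangent_slice new uniq1 phi1F phi1A A1p kerA).
- split; first exact: (psi_Z2T new phi1F).
  exact: (quot_psi_iso new uniq1 phi1F phi1A A1p kerA).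
- exact: (tangent_LTA uniq1 phi1F phi1A kerA1 solA1).
- exact: (i2bar_H2T new uniq1 phi1F phi1A A1p kerA).
move=> N D j.
have [sDN kerj limgj dimj] := homology_hyperplane new uniq1 phiT phi1F phi1A A1p.
split; [exact: sDN|exact: kerj|exact: limgj|exact: dimj|].
exact: (H2T_hyperplane_dual new uniq1 phiT phi1F phi1A A1p kerA).
Qed.
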